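(* The fully reduced symmetric configuration space $\widetilde{\mathcal{SC}}(\Gamma)$ of the planar equilateral pentagon $\Gamma$ is homeomorphic to a closed disc.
   Context: The planar equilateral pentagon $\Gamma$ is the 5-cycle graph with vertices $V=\{A_1,\dotsc,A_5\}$ and edges $A_iA_{i+1}$ (indices mod $5$), all of the same prescribed positive length $\ell$. Its configuration space $\mathcal C(\Gamma)\subseteq(\mathbb R^2)^V$ is the set of maps $\mathbf x:V\to\mathbb R^2$ with $\|\mathbf x(A_i)-\mathbf x(A_{i+1})\|=\ell$ for all $i$ (crossings and coincidences are allowed). The fully reduced configuration space is $\widetilde{\mathcal C}(\Gamma)=\mathcal C(\Gamma)/\operatorname{Euc}^2$, the quotient by all isometries of $\mathbb R^2$. $\operatorname{Aut}(\Gamma)$ is the group (dihedral of order 10) of permutations of $V$ preserving adjacency and edge lengths; it acts by $\mathbf x\mapsto\mathbf x\circ f$, and the fully reduced symmetric configuration space is $\widetilde{\mathcal{SC}}(\Gamma)=\widetilde{\mathcal C}(\Gamma)/\operatorname{Aut}(\Gamma)$. *)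

(* Defs.v *)
From HB Require Import structures.
From mathcomp Require Import all_fingroup all_boot all_order all_algebra.
From mathcomp Require Import all_classical all_reals all_analysis.

Set Implicit Arguments.
Unset Strict Implicit.
Unset Printing Implicit Defensive.

Import Order.TTheory GRing.Theory Num.Theory.
Import numFieldNormedType.Exports.

Local Open Scope classical_set_scope.
Local Open Scope ring_scope.
Local Open Scope quotient_scope.

(* The library norm on 'rV[R]_2 is the sup norm: it induces the usual topology
   of the plane, but distances have to be measured with [enorm]. *)
Definition enorm (R : realType) (u : 'rV[R]_2) : R :=
  Num.sqrt (\sum_(i < 2) u ord0 i ^+ 2).

Definition edist (R : realType) (p q : 'rV[R]_2) : R := enorm (p - q).

Definition euclidean_group (R : realType) : set ('rV[R]_2 -> 'rV[R]_2) :=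
  [set g | bijective g /\ forall p q, edist (g p) (g q) = edist p q].

Definition closed_disc (R : realType) : set 'rV[R]_2 :=
  [set p | enorm p <= 1].

Arguments euclidean_group : clear implicits.
Arguments closed_disc : clear implicits.

Definition homeomorphic (X Y : topologicalType) : Prop :=
  exists (f : X -> Y) (g : Y -> X),
    [/\ cancel f g, cancel g f, continuous f & continuous g].

Record linkage (R : realType) (V : finType) := Linkage {
  edge : rel V;
  elength : V -> V -> R;
  edge_sym : symmetric edge;
  edge_irr : irreflexive edge;
  elength_sym : forall u v, elength u v = elength v u;
  elength_gt0 : forall u v, edge u v -> 0 < elength u v }.

Section ConfigurationSpaces.
Context {R : realType} {V : finType} (G : linkage R V).

Definition conf_space : set {ptws V -> 'rV[R]_2} :=
  [set x | forall u v, edge G u v -> edist (x u) (x v) = elength G u v].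

Definition linkage_aut : {set {perm V}} :=
  [set f : {perm V} | [forall u, forall v,
     (edge G (f u) (f v) == edge G u v) &&
     (edge G u v ==> (elength G (f u) (f v) == elength G u v))]]%SET.

Lemma linkage_autP (f : {perm V}) :
  reflect ((forall u v, edge G (f u) (f v) = edge G u v) /\
           (forall u v, edge G u v -> elength G (f u) (f v) = elength G u v))
          (f \in linkage_aut).
Proof.
rewrite inE; apply: (iffP 'forall_forallP) => [H|[He Hl] u v].
  split=> u v; first by have /andP[/eqP] := H u v.
  by move=> uv; have /andP[_ /implyP/(_ uv)/eqP] := H u v.
by rewrite He eqxx /=; apply/implyP => /Hl ->.
Qed.

Lemma linkage_aut_group_set : group_set linkage_aut.
Proof.
apply/group_setP; split.
  by apply/linkage_autP; split=> u v; rewrite !perm1.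
move=> f g /linkage_autP[fe fl] /linkage_autP[ge gl].
apply/linkage_autP; split=> u v; rewrite !permM ?ge ?fe // => uv.
by rewrite gl ?fe // fl.
Qed.

Canonical linkage_aut_group := group linkage_aut_group_set.

Definition euc_equiv (x y : conf_space) : bool :=
  `[< exists2 g, euclidean_group R g &
        forall v, set_val y v = g (set_val x v) >].

Lemma euc_equiv_refl : reflexive euc_equiv.
Proof. by move=> x; apply/asboolP; exists id => //; split=> //; exists id. Qed.

Lemma euc_equiv_imp (x y : conf_space) : euc_equiv x y -> euc_equiv y x.
Proof.
move=> /asboolP[g [[h gK hK] gd] gE]; apply/asboolP; exists h.
  by split=> [|p q]; [exists g | rewrite -gd !hK].
by move=> v; rewrite gE gK.
Qed.

Lemma euc_equiv_sym : symmetric euc_equiv.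
Proof. by move=> x y; apply/idP/idP; exact: euc_equiv_imp. Qed.

Lemma euc_equiv_trans : transitive euc_equiv.
Proof.
move=> y x z /asboolP[g [gb gd] gE] /asboolP[h [hb hd] hE].
apply/asboolP; exists (h \o g).
  by split=> [|p q]; [exact: bij_comp | rewrite /= hd gd].
by move=> v; rewrite hE gE.
Qed.

Definition euc_rel :=
  EquivRel euc_equiv euc_equiv_refl euc_equiv_sym euc_equiv_trans.

Definition reduced_conf_space := {eq_quot euc_rel}.

HB.instance Definition _ :=
  Topological.copy reduced_conf_space (quotient_topology reduced_conf_space).
HB.instance Definition _ := Quotient.on reduced_conf_space.

Lemma reduced_piP (x y : conf_space) :
  reflect (\pi_reduced_conf_space x = \pi_reduced_conf_space y) (euc_equiv x y).
Proof. exact: (@eqquotP _ euc_rel {eq_quot euc_rel}). Qed.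

Lemma conf_act_subproof (f : [subg linkage_aut]) (x : conf_space) :
  conf_space (set_val x \o sgval f).
Proof.
move=> u v uv /=; have /linkage_autP[fe fl] := subgP f.
have /set_mem xC := valP x.
by rewrite xC ?fe // fl.
Qed.

Definition conf_act (f : [subg linkage_aut]) (x : conf_space) : conf_space :=
  exist _ (set_val x \o sgval f) (mem_set (conf_act_subproof f x)).

Definition reduced_act (f : [subg linkage_aut]) (p : reduced_conf_space) :
  reduced_conf_space := \pi_reduced_conf_space (conf_act f (repr p)).

Lemma reduced_act_pi f (x : conf_space) :
  reduced_act f (\pi_reduced_conf_space x) = \pi_reduced_conf_space (conf_act f x).
Proof.
apply/reduced_piP.
have /reduced_piP/asboolP[g gE xE] := reprK (\pi_reduced_conf_space x).
by apply/asboolP; exists g => // v; exact: xE.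
Qed.

Lemma reduced_act1 p : reduced_act 1%g p = p.
Proof.
rewrite -[p]reprK reduced_act_pi; congr (\pi_reduced_conf_space _).
by apply: val_inj; apply/funext => v; rewrite /= perm1.
Qed.

(* Permutations compose from left to right, (f * g) u = g (f u), so that
   precomposition, x |-> x \o f, is here a left action. *)
Lemma reduced_actM f g p :
  reduced_act (f * g)%g p = reduced_act f (reduced_act g p).
Proof.
rewrite -[p]reprK reduced_act_pi (reduced_act_pi g) reduced_act_pi.
congr (\pi_reduced_conf_space _).
by apply: val_inj; apply/funext => v; rewrite /= permM.
Qed.

Definition aut_equiv (p q : reduced_conf_space) : bool :=
  `[< exists f : [subg linkage_aut], q = reduced_act f p >].

Lemma aut_equiv_refl : reflexive aut_equiv.
Proof. by move=> p; apply/asboolP; exists 1%g; rewrite reduced_act1. Qed.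

Lemma aut_equiv_imp p q : aut_equiv p q -> aut_equiv q p.
Proof.
move=> /asboolP[f ->]; apply/asboolP; exists f^-1%g.
by rewrite -reduced_actM mulVg reduced_act1.
Qed.

Lemma aut_equiv_sym : symmetric aut_equiv.
Proof. by move=> p q; apply/idP/idP; exact: aut_equiv_imp. Qed.

Lemma aut_equiv_trans : transitive aut_equiv.
Proof.
move=> q p r /asboolP[f ->] /asboolP[g ->]; apply/asboolP.
by exists (g * f)%g; rewrite reduced_actM.
Qed.

Definition aut_rel :=
  EquivRel aut_equiv aut_equiv_refl aut_equiv_sym aut_equiv_trans.

Definition sym_reduced_conf_space := {eq_quot aut_rel}.

HB.instance Definition _ :=
  Topological.copy sym_reduced_conf_space (quotient_topology sym_reduced_conf_space).
HB.instance Definition _ := Quotient.on sym_reduced_conf_space.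

End ConfigurationSpaces.

Section Pentagon.
Context {R : realType} (l : R).

(* [ordS] is the cyclic successor of 'I_5, i.e. i |-> i + 1 mod 5. *)
Definition pentagon_edge : rel 'I_5 :=
  fun i j => (j == ordS i) || (i == ordS j).

Lemma pentagon_edge_sym : symmetric pentagon_edge.
Proof. by move=> i j; rewrite /pentagon_edge orbC. Qed.

Lemma pentagon_edge_irr : irreflexive pentagon_edge.
Proof. by case; do 5?case=> //. Qed.

Definition pentagon (l_gt0 : 0 < l) : linkage R 'I_5 :=
  Linkage pentagon_edge_sym pentagon_edge_irr
    (elength := fun _ _ => l) (fun _ _ => erefl) (fun _ _ _ => l_gt0).

End Pentagon.

(* Main.v *)
Require Import Defs.
From mathcomp Require Import all_fingroup all_boot all_order all_algebra.
From mathcomp Require Import lra.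
From mathcomp Require Import all_classical all_reals all_analysis.
Require Import Defs.

(** The edges of a configuration, divided by l, are five unit vectors
    u_0, ..., u_4 of the plane with sum zero. Modulo isometries they are the
    same thing as their Gram matrix c i j = u_i . u_j, on which the automorphism
    group acts by the dihedral permutations of the five indices. The larger
    group S_5 acts too, since reordering the edges keeps the sum zero, and
    reordering them by direction makes the pentagon convex.

    Convex equilateral pentagons modulo their own dihedral symmetries form a
    curved triangle: with x and y the two longest diagonals, it is given by
    1 + x <= y^2 and y <= x <= 2. Its vertices are the regular pentagon P, the
    trapezoid M with sides 2, 1, 1, 1 and the triangle Q with sides 2, 2, 1. Hence
    the space of Gram matrices is covered by the images under S_5 of one closed
    chamber, cut out by polynomial inequalities in a = c 0 1 and b = c 2 3, where
    x^2 = 2 + 2 a and y^2 = 2 + 2 b. Every matrix has a relabelling in the chamber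
    ([exists_chamber]), a matrix of the chamber is determined by a and b
    ([chamber_rigid]), and a and b are the two largest entries, so that two
    relabellings of c in the chamber are the same matrix ([chamber_relabel_eq]).
    The quantities 1 - a, 4 b^2 + 4 b - 1 - 2 a and a - b, which vanish on the
    three sides, give after division by their sum the weights of P, Q and M.

    Modulo the dihedral group D_5 only 120 / 10 = 12 chambers remain. A chamber,
    i.e. a relabelling s, is known modulo D_5 from the bits telling which pairs
    s i, s j are adjacent edges of the pentagon, and each vertex of the chamber
    carries a label read off these bits: four labels for P, three for Q, four for
    M. Placed at suitable points of the square [-1, 1]^2, these eleven vertices
    triangulate it into twelve triangles ([bary_inj], [bary_surj]). Sending c to
    the point of its triangle with the weights above is well defined, because a
    relabelling fixing c preserves the labels of nonzero weight ([label_P_inv],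
    [label_Q_inv], [label_M_inv]). It is injective modulo D_5, because the labels
    of nonzero weight determine s up to D_5 and up to mirror relabellings fixing
    c ([label_merge], a finite computation).

    This map is continuous on each of the finitely many closed pieces where a
    given relabelling lies in the chamber, hence continuous. Composed with the
    radial homeomorphism from the square to the disc it gives a continuous
    bijection from the quotient, which is compact because translations allow the
    first vertex to be put at the origin, onto the disc. *)

Set Implicit Arguments.
Unset Strict Implicit.
Unset Printing Implicit Defensive.

Import Order.TTheory GRing.Theory Num.Theory numFieldNormedType.Exports.
Local Open Scope ring_scope.

(** * Gram matrices of closed equilateral pentagons *)

Notation i0 := (@Ordinal 5 0 isT).
Notation i1 := (@Ordinal 5 1 isT).
Notation i2 := (@Ordinal 5 2 isT).
Notation i3 := (@Ordinal 5 3 isT).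
Notation i4 := (@Ordinal 5 4 isT).

Section Algebra.
Variable R : realFieldType.
Implicit Types (c : 'I_5 -> 'I_5 -> R).

Lemma sum5 (F : 'I_5 -> R) : \sum_(i < 5) F i = F i0 + F i1 + F i2 + F i3 + F i4.
Proof.
rewrite !big_ord_recl big_ord0 addr0 !addrA.
by congr (F _ + F _ + F _ + F _ + F _); exact: val_inj.
Qed.

Definition gram5 c := exists X Y : 'I_5 -> R,
  [/\ forall i j, c i j = X i * X j + Y i * Y j, forall i, c i i = 1,
      \sum_i X i = 0 & \sum_i Y i = 0].

Definition relabel (s : 'I_5 -> 'I_5) c := fun i j => c (s i) (s j).

Lemma gram5_relabel c (s : {perm 'I_5}) : gram5 c -> gram5 (relabel s c).
Proof.
move=> [X [Y [cE c1 X0 Y0]]]; exists (X \o s), (Y \o s); split => //=.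
- by move=> i j; rewrite /relabel cE.
- by move=> i; rewrite /relabel.
- by rewrite -[RHS]X0 [RHS](reindex_inj (@perm_inj _ s)).
- by rewrite -[RHS]Y0 [RHS](reindex_inj (@perm_inj _ s)).
Qed.

Section Gram.
Variable c : 'I_5 -> 'I_5 -> R.
Hypothesis cG : gram5 c.

Lemma gram_sym i j : c i j = c j i.
Proof. by case: cG => [X [Y [cE _ _ _]]]; rewrite !cE; lra. Qed.

Lemma gram_diag i : c i i = 1.
Proof. by case: cG => [X [Y []]]. Qed.

Lemma gram_row i : c i i0 + c i i1 + c i i2 + c i i3 + c i i4 = 0.
Proof.
case: cG => [X [Y [cE _]]]; rewrite !sum5 => X0 Y0; rewrite !cE.
transitivity (X i * (X i0 + X i1 + X i2 + X i3 + X i4) +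
              Y i * (Y i0 + Y i1 + Y i2 + Y i3 + Y i4)); first by lra.
by rewrite X0 Y0; lra.
Qed.

Lemma gram_minor i j k i' j' k' :
  c i i' * (c j j' * c k k' - c j k' * c k j') -
  c i j' * (c j i' * c k k' - c j k' * c k i') +
  c i k' * (c j i' * c k j' - c j j' * c k i') = 0.
Proof. by case: cG => [X [Y [cE _ _ _]]]; rewrite !cE; lra. Qed.

Lemma gram_tri i j k :
  1 + 2 * c i j * c i k * c j k - c i j ^+ 2 - c i k ^+ 2 - c j k ^+ 2 = 0.
Proof.
have := gram_minor i j k i j k.
rewrite !gram_diag (gram_sym j i) (gram_sym k i) (gram_sym k j) => <-; lra.
Qed.

Lemma gram_bound i j : -1 <= c i j <= 1.
Proof.
case: cG => [X [Y [cE c1 _ _]]]; have := c1 i; have := c1 j; rewrite !cE.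
have := sqr_ge0 (X i - X j); have := sqr_ge0 (Y i - Y j).
have := sqr_ge0 (X i + X j); have := sqr_ge0 (Y i + Y j).
by rewrite !expr2; lra.
Qed.

(** Equality holds for the regular pentagon with its edges in the order
    i, j, k, l, m, and z = cos 72. Modulo the all-ones vector, the coefficients
    of the two squares N1 and N2 span the kernel of the Gram matrix of that
    pentagon. *)
Lemma gram_path (z : R) : 0 < z -> z ^+ 2 = (1 - 2 * z) / 4 ->
  forall i j k l m : 'I_5, uniq [:: i; j; k; l; m] ->
  (2 * z + 1) * c j k + c i j + c k l <= z * (2 * z + 3).
Proof.
move=> z0 z2 i j k l m ijklm.
case: cG => [X [Y [cE c1 X0 Y0]]].
have sumE (F : 'I_5 -> R) : \sum_i F i = F i + F j + F k + F l + F m.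
  have pE : perm_eq (index_enum 'I_5) [:: i; j; k; l; m].
    rewrite perm_sym; apply: uniq_perm => [//||x]; first exact: index_enum_uniq.
    rewrite mem_index_enum; apply: contraT => xN.
    have := max_card (mem (x :: [:: i; j; k; l; m])).
    by rewrite card_ord (card_uniqP _) // cons_uniq ijklm xN.
  by rewrite (perm_big _ pE) !big_cons big_nil /= addr0 !addrA.
have Xm : X m = - (X i + X j + X k + X l).
  by apply/eqP; rewrite -addr_eq0 addrC -sumE X0.
have Ym : Y m = - (Y i + Y j + Y k + Y l).
  by apply/eqP; rewrite -addr_eq0 addrC -sumE Y0.
have mm := c1 m; rewrite cE Xm Ym in mm.
(* N1 is odd and N2 is even under the reversal of i, j, k, l. *)
have N1 := addr_ge0 (sqr_ge0 (X j - 2 * z * X i - X k + 2 * z * X l))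
                    (sqr_ge0 (Y j - 2 * z * Y i - Y k + 2 * z * Y l)).
have N2 := addr_ge0 (sqr_ge0 ((1 - 2 * z) * (X j + X k) + X i + X l))
                    (sqr_ge0 ((1 - 2 * z) * (Y j + Y k) + Y i + Y l)).
have ii := c1 i; have jj := c1 j; have kk := c1 k; have ll := c1 l.
have E1 : (X j - 2 * z * X i - X k + 2 * z * X l) ^+ 2 +
   (Y j - 2 * z * Y i - Y k + 2 * z * Y l) ^+ 2 =
   4 * z ^+ 2 * c i i + c j j + c k k + 4 * z ^+ 2 * c l l
   + 2 * (- 2 * z * c i j + 2 * z * c i k - 4 * z ^+ 2 * c i l - c j k
          + 2 * z * c j l - 2 * z * c k l) by rewrite !cE; lra.
have E2 : ((1 - 2 * z) * (X j + X k) + X i + X l) ^+ 2 +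
  ((1 - 2 * z) * (Y j + Y k) + Y i + Y l) ^+ 2 =
  c i i + c l l + (1 - 2 * z) ^+ 2 * (c j j + c k k) +
  2 * ((1 - 2 * z) * (c i j + c i k + c j l + c k l) + c i l
       + (1 - 2 * z) ^+ 2 * c j k) by rewrite !cE; lra.
have E3 : c i i + c j j + c k k + c l l +
   2 * (c i j + c i k + c i l + c j k + c j l + c k l) = 1.
  by apply: etrans mm; rewrite !cE; lra.
rewrite {}E1 ii jj kk ll in N1; rewrite {}E2 ii jj kk ll in N2.
rewrite ii jj kk ll in E3.
have cil : c i l = -3 / 2 - (c i j + c i k + c j k + c j l + c k l) by lra.
have N : 0 <= 8 * z * (z * (2 * z + 3) - ((2 * z + 1) * c j k + c i j + c k l)).
  have N2' : 0 <= 1 + 2 * z by lra.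
  have := addr_ge0 N1 (mulr_ge0 N2' N2).
  congr (0 <= _); rewrite cil; apply/eqP; rewrite -subr_eq0; apply/eqP.
  (* The difference of the two sides is a multiple of the equation for z. *)
  transitivity ((4 * z ^+ 2 + 2 * z - 1) * ((4 * z + 2) * c j k - 3)); first by lra.
  by rewrite z2; lra.
have z8 : 0 < 8 * z by lra.
by move: N; rewrite (pmulr_rge0 _ z8) subr_ge0.
Qed.

Lemma gram_rows :
  [/\ c i0 i1 + c i0 i2 + c i0 i3 + c i0 i4 = -1,
      c i0 i1 + c i1 i2 + c i1 i3 + c i1 i4 = -1,
      c i0 i2 + c i1 i2 + c i2 i3 + c i2 i4 = -1,
      c i0 i3 + c i1 i3 + c i2 i3 + c i3 i4 = -1 &
      c i0 i4 + c i1 i4 + c i2 i4 + c i3 i4 = -1].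
Proof.
have := gram_row i0; have := gram_row i1; have := gram_row i2.
have := gram_row i3; have := gram_row i4; rewrite !gram_diag.
rewrite (gram_sym i1 i0) (gram_sym i2 i0) (gram_sym i3 i0) (gram_sym i4 i0).
rewrite (gram_sym i2 i1) (gram_sym i3 i1) (gram_sym i4 i1).
rewrite (gram_sym i3 i2) (gram_sym i4 i2) (gram_sym i4 i3).
by move=> *; split; lra.
Qed.

(** The law of cosines for the triangle with sides u_0 + u_1, u_2 + u_3 and
    u_4. *)
Lemma gram_apex : c i0 i4 + c i1 i4 = c i2 i3 - c i0 i1 - 1 / 2 /\
                  c i2 i4 + c i3 i4 = c i0 i1 - c i2 i3 - 1 / 2.
Proof. by case: gram_rows => *; split; lra. Qed.

End Gram.

(** Three unit vectors of the plane have a singular Gram matrix. With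
    a = cos t, the case a = b leaves d = 1 or d = cos (2 t), whence the two
    factors on the right. *)
Lemma triple_identity (a b d : R) :
  1 + 2 * a * b * d - a ^+ 2 - b ^+ 2 - d ^+ 2 = 0 ->
  2 * (1 + a) * ((a - b) * (a - d)) =
  (b + d - (a + 1)) * (b + d - (a + 1) * (2 * a - 1)).
Proof.
move=> h; apply/eqP; rewrite -subr_eq0; apply/eqP.
apply: etrans h; lra.
Qed.

End Algebra.

(** * The chamber of convex pentagons *)

Section Chamber.
Variable R : rcfType.
Implicit Types (c d : 'I_5 -> 'I_5 -> R).

(** With x = |u_0 + u_1| and y = |u_2 + u_3| this is (y^2 - 1)^2 - x^2. *)
Definition slack c : R := 4 * c i2 i3 ^+ 2 + 4 * c i2 i3 - 1 - 2 * c i0 i1.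

(** The first two inequalities say that the edge vectors turn in the order
    0, 1, 2, 3, 4, the others that the two diagonals x = |u_0 + u_1| and
    y = |u_2 + u_3| satisfy 1 + x <= y^2 and y <= x. *)
Definition chamber c := [&& c i1 i4 <= c i0 i4, c i2 i4 <= c i3 i4,
  c i2 i3 <= c i0 i1, 0 <= c i2 i3 & 0 <= slack c].

(** Let x be the length of the sum of three unit vectors, and y that of the
    sum of the closest two. Given y, the length x is largest when the vectors are
    equally spaced, and then y^2 = 1 + x. *)
Lemma triple_bound (A a u v : R) : A <= 1 -> -1 <= a -> a <= A -> u <= a -> v <= a ->
  2 * (1 + a) * ((a - u) * (a - v)) =
    (u + v - (a + 1)) * (u + v - (a + 1) * (2 * a - 1)) ->
  u + v = A - a - 1 / 2 -> 0 <= 4 * a ^+ 2 + 4 * a - 1 - 2 * A.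
Proof.
move=> A1 a1 aA ua va I tE.
have P : 0 <= 2 * (1 + a) * ((a - u) * (a - v)).
  by apply: mulr_ge0; [lra | apply: mulr_ge0; lra].
rewrite I in P.
have -> : 4 * a ^+ 2 + 4 * a - 1 - 2 * A = 2 * ((a + 1) * (2 * a - 1) - (u + v)).
  by rewrite tE; lra.
have [H|H] := lerP (u + v) ((a + 1) * (2 * a - 1)); first lra.
have H2 : 0 < u + v - (a + 1) * (2 * a - 1) by lra.
rewrite (pmulr_lge0 _ H2) in P.
have a_eq1 : a = 1 by lra.
rewrite a_eq1 in P H *; lra.
Qed.

(** A greedy choice leads to the chamber: first a closest pair u_0, u_1, then
    a closest pair u_2, u_3 among the remaining three vectors. *)
Lemma chamber_of_order c : gram5 c ->
    c i1 i4 <= c i0 i4 -> c i2 i4 <= c i3 i4 ->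
    (forall i j, i != j -> c i j <= c i0 i1) ->
    c i3 i4 <= c i2 i3 -> chamber c.
Proof.
move=> cG s0 t0 amax tb.
have [_ tE] := gram_apex cG.
have /andP[a0 a1] := gram_bound cG i0 i1.
have /andP[b0 b1] := gram_bound cG i2 i3.
have bA := amax i2 i3 isT.
have T := gram_tri cG i2 i3 i4; have I := triple_identity T.
have G : 0 <= slack c.
  apply: (@triple_bound (c i0 i1) (c i2 i3) (c i2 i4) (c i3 i4)) => //; lra.
apply/and5P; split => //.
(* The ten entries off the diagonal add up to -5 / 2. *)
have a4 : -1 / 4 <= c i0 i1.
  have [r0 r1 r2 r3 r4] := gram_rows cG.
  have A1 := amax i0 i2 isT; have A2 := amax i0 i3 isT.
  have A3 := amax i0 i4 isT; have A4 := amax i1 i2 isT.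
  have A5 := amax i1 i3 isT; have A6 := amax i1 i4 isT.
  have A8 := amax i2 i4 isT; have A9 := amax i3 i4 isT.
  lra.
rewrite leNgt; apply/negP => b_lt0; move: G; rewrite /slack.
have : c i2 i3 * (1 + c i2 i3) <= 0 by rewrite mulr_le0_ge0; lra.
rewrite expr2 mulrDr mulr1; lra.
Qed.

Section Bounds.
Variable c : 'I_5 -> 'I_5 -> R.
Hypothesis cG : gram5 c.
Hypothesis cC : chamber c.
Let a := c i0 i1.
Let b := c i2 i3.

Lemma chamber_b_le1 : b <= 1.
Proof. by case/andP: (gram_bound cG i2 i3). Qed.

Lemma chamber_a_le1 : a <= 1.
Proof. by case/andP: (gram_bound cG i0 i1). Qed.

(** That is, b is at least cos 72, its value at the regular pentagon. *)
Lemma chamber_b_golden : 0 <= 4 * b ^+ 2 + 2 * b - 1.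
Proof. by case/and5P: cC => _ _ ab _; rewrite /slack -/a -/b; move: ab; rewrite -/a -/b; lra. Qed.

Lemma chamber_apex_le : 2 * b ^+ 2 + 2 * b - 1 / 2 >= a.
Proof. by case/and5P: cC => _ _ _ _; rewrite /slack -/a -/b; lra. Qed.

Lemma chamber_b_ge0 : 0 <= b. Proof. by case/and5P: cC. Qed.
Lemma chamber_b_le_a : b <= a. Proof. by case/and5P: cC. Qed.

(** The vectors u_0 + u_1 and u_0 - u_1 are orthogonal, and u_4 is the sum of
    its projections on them. *)
Lemma chamber_s_sqr : (1 + a) * (c i0 i4 - c i1 i4) ^+ 2 =
  2 * (1 - a ^+ 2) - (b - a - 1 / 2) ^+ 2 * (1 - a).
Proof.
have [sE _] := gram_apex cG; have T := gram_tri cG i0 i1 i4.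
rewrite -/a in T *; have -> : b - a - 1 / 2 = c i0 i4 + c i1 i4 by rewrite sE.
apply/eqP; rewrite -subr_eq0; apply/eqP.
transitivity (- 2 * (1 + 2 * a * c i0 i4 * c i1 i4 - a ^+ 2 - c i0 i4 ^+ 2 - c i1 i4 ^+ 2)).
  lra.
by rewrite T mulr0.
Qed.

Lemma chamber_t_sqr : (1 + b) * (c i3 i4 - c i2 i4) ^+ 2 =
  2 * (1 - b ^+ 2) - (a - b - 1 / 2) ^+ 2 * (1 - b).
Proof.
have [_ tE] := gram_apex cG; have T := gram_tri cG i2 i3 i4.
rewrite -/b in T *; have -> : a - b - 1 / 2 = c i2 i4 + c i3 i4 by rewrite tE.
apply/eqP; rewrite -subr_eq0; apply/eqP.
transitivity (- 2 * (1 + 2 * b * c i2 i4 * c i3 i4 - b ^+ 2 - c i2 i4 ^+ 2 - c i3 i4 ^+ 2)).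
  lra.
by rewrite T mulr0.
Qed.

(** The right-hand side increases with a, and for a = b it equals the
    left-hand side. *)
Lemma chamber_s_core :
  (4 * b ^+ 2 + 2 * b - 1) * (b / 2 + 3 / 4) <=
  (a + 1 / 2) ^+ 2 + b ^+ 2 + a ^+ 2 + 2 * a * b * (a + 1 / 2) - 1.
Proof.
have ba := chamber_b_le_a; have b0 := chamber_b_ge0.
have -> : (4 * b ^+ 2 + 2 * b - 1) * (b / 2 + 3 / 4) =
  (b + 1 / 2) ^+ 2 + b ^+ 2 + b ^+ 2 + 2 * b * b * (b + 1 / 2) - 1 by lra.
rewrite -subr_ge0.
have -> : (a + 1 / 2) ^+ 2 + b ^+ 2 + a ^+ 2 + 2 * a * b * (a + 1 / 2) - 1 -
   ((b + 1 / 2) ^+ 2 + b ^+ 2 + b ^+ 2 + 2 * b * b * (b + 1 / 2) - 1) =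
   (a - b) * (a + b + 1 + (a + b) + 2 * b * (a + b) + b) by lra.
apply: mulr_ge0; first by lra.
have : 0 <= b * (a + b) by apply: mulr_ge0; lra.
by lra.
Qed.

(** Otherwise c 0 4 - c 1 4 > a + b + 1 / 2, and squaring contradicts
    [chamber_s_core]. *)
Lemma chamber_s_le : c i0 i4 <= b.
Proof.
have ba := chamber_b_le_a; have b0 := chamber_b_ge0.
have [sE _] := gram_apex cG; rewrite -/a -/b in sE.
rewrite leNgt; apply/negP => H.
have H2 : a + b + 1 / 2 < c i0 i4 - c i1 i4 by lra.
have H3 : (a + b + 1 / 2) ^+ 2 < (c i0 i4 - c i1 i4) ^+ 2.
  by rewrite ltr_pXn2r // nnegrE; lra.
have a0 : 0 < 1 + a by lra.
rewrite -(ltr_pM2l a0) chamber_s_sqr in H3.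
have := chamber_s_core; have C := chamber_b_golden.
have : 0 <= (4 * b ^+ 2 + 2 * b - 1) * (b / 2 + 3 / 4) by apply: mulr_ge0 => //; lra.
nra.
Qed.

Lemma chamber_s_lt : 0 < 4 * b ^+ 2 + 2 * b - 1 -> c i0 i4 < b.
Proof.
have ba := chamber_b_le_a; have b0 := chamber_b_ge0.
move=> C; rewrite lt_neqAle chamber_s_le andbT; apply/eqP => sb.
have [sE _] := gram_apex cG; rewrite -/a -/b in sE.
have E : c i0 i4 - c i1 i4 = a + b + 1 / 2 by lra.
have := chamber_s_sqr; rewrite E.
have := chamber_s_core.
have : 0 < (4 * b ^+ 2 + 2 * b - 1) * (b / 2 + 3 / 4) by apply: mulr_gt0 => //; lra.
nra.
Qed.

Lemma chamber_t_le : c i3 i4 <= b.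
Proof.
have ba := chamber_b_le_a; have b0 := chamber_b_ge0.
have /and5P[_ t0 _ _ g0] := cC.
have [_ tE] := gram_apex cG; rewrite -/a -/b in tE.
have T := gram_tri cG i2 i3 i4; have I := triple_identity T.
have b1 := chamber_b_le1.
have gE : (b + 1) * (2 * b - 1) - (c i2 i4 + c i3 i4) = slack c / 2.
  by rewrite tE /slack -/a -/b; lra.
have P : 0 <= 2 * (1 + b) * ((b - c i2 i4) * (b - c i3 i4)).
  rewrite I -/b mulr_le0 //; last by lra.
  rewrite tE; have := chamber_apex_le; nra.
rewrite leNgt; apply/negP => H.
have H2 : b - c i3 i4 < 0 by lra.
have b1' : 0 < 2 * (1 + b) by lra.
rewrite (pmulr_rge0 _ b1') (nmulr_lge0 _ H2) in P.
have := gram_bound cG i3 i4; case/andP => _ u1.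
have : 2 * b <= (b + 1) * (2 * b - 1) by lra.
have : (1 - b) * (2 * b + 1) > 0 by apply: mulr_gt0; lra.
nra.
Qed.

(** The side 1 + x = y^2 of the chamber consists of the pentagons where
    u_2, u_3, u_4 are equally spaced, so that the edge 3 lies on a mirror axis. *)
Lemma chamber_t_slack : c i3 i4 = b <-> slack c = 0.
Proof.
have ba := chamber_b_le_a; have b0 := chamber_b_ge0.
have /and5P[_ t0 _ _ g0] := cC.
have [_ tE] := gram_apex cG; rewrite -/a -/b in tE.
have T := gram_tri cG i2 i3 i4; have I := triple_identity T.
have b1 := chamber_b_le1.
have gE : (c i2 i4 + c i3 i4) - (b + 1) * (2 * b - 1) = - slack c / 2.
  by rewrite tE /slack -/a -/b; lra.
rewrite -/b gE in I; split => [tb|g].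
  have a1 := chamber_a_le1.
  move/eqP: I; rewrite tb subrr !mulr0 eq_sym mulf_eq0 => /orP[/eqP H|/eqP]; last by lra.
  lra.
move/eqP: I; rewrite g oppr0 mul0r mulr0 !mulf_eq0 => /orP[/orP[/eqP|/eqP]|/orP[/eqP|/eqP]]; try lra.
move=> H; have := chamber_t_le; lra.
Qed.

Lemma chamber_cross_le (z : R) : 0 < z -> z ^+ 2 = (1 - 2 * z) / 4 ->
  [/\ c i0 i2 <= z, c i0 i3 <= z, c i1 i2 <= z & c i1 i3 <= z] /\ z <= b.
Proof.
have ba := chamber_b_le_a; have b0 := chamber_b_ge0.
move=> z0 z2.
have zb : z <= b.
  rewrite leNgt; apply/negP => H; have := chamber_b_golden.
  have : b ^+ 2 < z ^+ 2 by rewrite ltr_pXn2r // nnegrE; lra.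
  lra.
split => //; have z1 : 0 < 2 * z + 1 by lra.
have zE : (2 * z + 1) * z = z * (2 * z + 3) - z - z by lra.
have P i j k l m := @gram_path _ c cG z z0 z2 i j k l m.
have := P i1 i0 i2 i3 i4 isT; have := P i1 i0 i3 i2 i4 isT.
have := P i0 i1 i2 i3 i4 isT; have := P i0 i1 i3 i2 i4 isT.
rewrite (gram_sym cG i1 i0) (gram_sym cG i3 i2) -/a -/b => *.
by split; rewrite -(ler_pM2l z1) zE; lra.
Qed.

End Bounds.
End Chamber.

(** * Rigidity and mirror symmetries of the chamber *)

Lemma ord5_ind (P : 'I_5 -> Prop) :
  P i0 -> P i1 -> P i2 -> P i3 -> P i4 -> forall i, P i.
Proof.
move=> P0 P1 P2 P3 P4; case=> [[|[|[|[|[|//]]]]] Hi].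
- by rewrite (_ : Ordinal _ = i0) //; exact: val_inj.
- by rewrite (_ : Ordinal _ = i1) //; exact: val_inj.
- by rewrite (_ : Ordinal _ = i2) //; exact: val_inj.
- by rewrite (_ : Ordinal _ = i3) //; exact: val_inj.
- by rewrite (_ : Ordinal _ = i4) //; exact: val_inj.
Qed.

Section Chamber.
Variable R : rcfType.
Implicit Types (c d : 'I_5 -> 'I_5 -> R).

(** This is the squared height of the triangle with sides u_0 + u_1,
    u_2 + u_3, u_4 over its side u_4: the triangle is not flat. *)
Lemma chamber_tau_gt0 c : gram5 c -> chamber c ->
  0 < 2 + 2 * c i0 i1 - (c i0 i1 - c i2 i3 + 1 / 2) ^+ 2.
Proof.
move=> cG cC; have ba := chamber_b_le_a cC; have b0 := chamber_b_ge0 cC.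
have a1 := chamber_a_le1 cG; rewrite expr2.
have : (c i0 i1 - c i2 i3 + 1 / 2) * (c i0 i1 - c i2 i3 + 1 / 2) <=
       (3 / 2) * (c i0 i1 - c i2 i3 + 1 / 2) by apply: ler_wpM2r; lra.
lra.
Qed.

(** The minor of the rows 0, 1, 4 and the columns 2, 3, 4, in the bases
    u_0 + u_1, u_0 - u_1, u_4 and u_2 + u_3, u_2 - u_3, u_4. It is linear in
    (u_0 - u_1) . (u_2 - u_3), the only product that the row sums and the products
    with u_4 leave undetermined. *)
Lemma chamber_cross_sign c : gram5 c ->
  (2 + 2 * c i0 i1 - (c i0 i1 - c i2 i3 + 1 / 2) ^+ 2) *
  (c i0 i2 - c i0 i3 - c i1 i2 + c i1 i3) =
  - ((c i0 i4 - c i1 i4) * (c i3 i4 - c i2 i4) *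
     ((3 + 2 * c i0 i1 + 2 * c i2 i3) / 2)).
Proof.
move=> cG; have [r0 r1 r2 r3 r4] := gram_rows cG; have [sE tE] := gram_apex cG.
have M := gram_minor cG i0 i1 i4 i2 i3 i4.
rewrite (gram_sym cG i4 i3) (gram_sym cG i4 i2) gram_diag // in M.
have s' : c i1 i4 = c i2 i3 - c i0 i1 - 1 / 2 - c i0 i4 by lra.
have t' : c i3 i4 = c i0 i1 - c i2 i3 - 1 / 2 - c i2 i4 by lra.
have e03 : c i0 i3 = -1 - c i0 i1 - c i0 i4 - c i0 i2 by lra.
have e12 : c i1 i2 = -1 - c i2 i3 - c i2 i4 - c i0 i2 by lra.
have e13 : c i1 i3 = -1 - c i0 i1 - c i1 i4 - c i1 i2 by lra.
rewrite e13 e12 e03 s' t' in M *.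
apply/eqP; rewrite -subr_eq0; apply/eqP.
transitivity (0 * (- 4 : R)); last by rewrite mul0r.
by rewrite -M; lra.
Qed.

(** The triangle with sides x, y, 1 is rigid, and the order of the edges
    tells on which side of x and of y the isosceles triangles with legs 1 lie. *)
Lemma chamber_rigid c d : gram5 c -> gram5 d -> chamber c -> chamber d ->
  c i0 i1 = d i0 i1 -> c i2 i3 = d i2 i3 -> forall i j, c i j = d i j.
Proof.
move=> cG dG cC dC ea eb.
have ba := chamber_b_le_a cC; have b0 := chamber_b_ge0 cC.
have [/and5P[cs ct _ _ _] /and5P[ds dt _ _ _]] := (cC, dC).
have [csE ctE] := gram_apex cG; have [dsE dtE] := gram_apex dG.
have es : c i0 i4 - c i1 i4 = d i0 i4 - d i1 i4.
  apply/eqP; rewrite -(@eqrXn2 _ 2) ?subr_ge0 //.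
  have a0 : 1 + c i0 i1 != 0 by lra.
  apply/eqP/(mulfI a0); rewrite (chamber_s_sqr cG) ea eb -(chamber_s_sqr dG) //.
have et : c i3 i4 - c i2 i4 = d i3 i4 - d i2 i4.
  apply/eqP; rewrite -(@eqrXn2 _ 2) ?subr_ge0 //.
  have a0 : 1 + c i2 i3 != 0 by lra.
  apply/eqP/(mulfI a0); rewrite (chamber_t_sqr cG) ea eb -(chamber_t_sqr dG) //.
have e04 : c i0 i4 = d i0 i4 by lra.
have e14 : c i1 i4 = d i1 i4 by lra.
have e24 : c i2 i4 = d i2 i4 by lra.
have e34 : c i3 i4 = d i3 i4 by lra.
have [r0 r1 r2 r3 r4] := gram_rows cG; have [q0 q1 q2 q3 q4] := gram_rows dG.
have eX : c i0 i2 - c i0 i3 - c i1 i2 + c i1 i3 =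
          d i0 i2 - d i0 i3 - d i1 i2 + d i1 i3.
  have /lt0r_neq0/mulfI := chamber_tau_gt0 cG cC; apply.
  by rewrite chamber_cross_sign // ea eb e04 e14 e24 e34 -chamber_cross_sign.
have e02 : c i0 i2 = d i0 i2 by lra.
have e03 : c i0 i3 = d i0 i3 by lra.
have e12 : c i1 i2 = d i1 i2 by lra.
have e13 : c i1 i3 = d i1 i3 by lra.
by elim/ord5_ind; elim/ord5_ind; rewrite ?gram_diag //;
   rewrite gram_sym // [RHS]gram_sym.
Qed.

Lemma chamber_cross_mono c : gram5 c -> chamber c -> c i0 i2 <= c i1 i2.
Proof.
move=> cG cC; have /and5P[s0 t0 _ _ _] := cC.
have ba := chamber_b_le_a cC; have b0 := chamber_b_ge0 cC.
have : c i0 i2 - c i0 i3 - c i1 i2 + c i1 i3 <= 0.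
  rewrite -(pmulr_rle0 _ (chamber_tau_gt0 cG cC)) chamber_cross_sign // oppr_le0.
  by rewrite !mulr_ge0 //; lra.
have [r0 r1 r2 r3 r4] := gram_rows cG; lra.
Qed.

(** Here u_i = u_j. *)
Lemma gram_eq_rows c i j : gram5 c -> c i j = 1 -> forall k, c i k = c j k.
Proof.
move=> [X [Y [cE c1 _ _]]] ij k.
have := c1 i; have := c1 j; rewrite !cE => jj ii; rewrite cE in ij.
have Z : (X i - X j) ^+ 2 + (Y i - Y j) ^+ 2 = 0 by rewrite !expr2; lra.
move/eqP: Z; rewrite paddr_eq0 ?sqr_ge0 // !sqrf_eq0 !subr_eq0.
by move=> /andP[/eqP-> /eqP->].
Qed.

(** Each of these relabellings fixes one side of the chamber: [refl_p]
    exchanges the coinciding edges when a = 1, while [refl_q] and [refl_m] are the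
    mirror symmetries of a convex pentagon through the edges 3 and 4, when the
    slack is zero and when a = b. *)
Definition refl_p : {perm 'I_5} := tperm i0 i1.
Definition refl_q : {perm 'I_5} := (tperm i0 i1 * tperm i2 i4)%g.
Definition refl_m : {perm 'I_5} := (tperm i0 i3 * tperm i1 i2)%g.

Lemma refl_pE : [/\ refl_p i0 = i1, refl_p i1 = i0, refl_p i2 = i2, refl_p i3 = i3 & refl_p i4 = i4].
Proof. by split; rewrite /refl_p permE. Qed.
Lemma refl_qE : [/\ refl_q i0 = i1, refl_q i1 = i0, refl_q i2 = i4, refl_q i3 = i3 & refl_q i4 = i2].
Proof. by split; rewrite /refl_q permM !permE. Qed.
Lemma refl_mE : [/\ refl_m i0 = i3, refl_m i1 = i2, refl_m i2 = i1, refl_m i3 = i0 & refl_m i4 = i4].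
Proof. by split; rewrite /refl_m permM !permE. Qed.

Lemma chamber_refl_p c : gram5 c -> c i0 i1 = 1 ->
  forall i j, c (refl_p i) (refl_p j) = c i j.
Proof.
move=> cG a1; have E := gram_eq_rows cG a1; have [e0 e1 e2 e3 e4] := refl_pE.
have E1 k : c i1 k = c i0 k by rewrite E.
have E2 k : c k i1 = c k i0 by rewrite gram_sym // E1 gram_sym.
by elim/ord5_ind; elim/ord5_ind; rewrite ?e0 ?e1 ?e2 ?e3 ?e4 ?E1 ?E2.
Qed.

Lemma chamber_refl_q c : gram5 c -> chamber c -> slack c = 0 ->
  forall i j, c (refl_q i) (refl_q j) = c i j.
Proof.
move=> cG cC g0; have [e0 e1 e2 e3 e4] := refl_qE.
have tb := (chamber_t_slack cG cC).2 g0.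
have := chamber_rigid (gram5_relabel refl_q cG) cG _ cC; apply; last 2 first.
- by rewrite /relabel e0 e1 gram_sym.
- by rewrite /relabel e2 e3 gram_sym.
have /and5P[s0 t0 ba b0 _] := cC.
have x := chamber_cross_mono cG cC.
rewrite /chamber /slack /relabel !(e0, e1, e2, e3, e4).
rewrite (gram_sym cG i1 i0) (gram_sym cG i4 i3) (gram_sym cG i4 i2) (gram_sym cG i3 i2) tb.
rewrite x ba b0 /= -/(slack c) g0 lexx andbT.
by rewrite -tb.
Qed.

Lemma chamber_refl_m c : gram5 c -> chamber c -> c i0 i1 = c i2 i3 ->
  forall i j, c (refl_m i) (refl_m j) = c i j.
Proof.
move=> cG cC ab; have [e0 e1 e2 e3 e4] := refl_mE.
have /and5P[s0 t0 ba b0 g0] := cC.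
have := chamber_rigid (gram5_relabel refl_m cG) cG _ cC; apply; last 2 first.
- by rewrite /relabel e0 e1 gram_sym.
- by rewrite /relabel e2 e3 gram_sym.
rewrite /chamber /slack /relabel !(e0, e1, e2, e3, e4).
rewrite (gram_sym cG i1 i0) (gram_sym cG i3 i2).
by move: g0; rewrite /slack s0 t0 ab b0 lexx.
Qed.

End Chamber.

(** * The chamber as a strict fundamental domain of the symmetric group *)

Lemma perm_two_points (T : finType) (x y i j : T) : x != y -> i != j ->
  exists t : {perm T}, t x = i /\ t y = j.
Proof.
move=> xy ij; pose z := tperm x i y.
have zi : z != i by rewrite /z -{2}(tpermL x i) (inj_eq perm_inj) eq_sym.
exists (tperm x i * tperm z j)%g; rewrite !permM tpermL; split.
  by rewrite tpermD // eq_sym.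
by rewrite -/z tpermL.
Qed.

Definition same_pair (i j x y : 'I_5) :=
  ((i == x) && (j == y)) || ((i == y) && (j == x)).

Section Chamber.
Variable R : rcfType.
Implicit Types (c d : 'I_5 -> 'I_5 -> R).

Lemma chamber_ext c d : (forall i j, c i j = d i j) -> chamber c = chamber d.
Proof. by move=> e; rewrite /chamber /slack !e. Qed.

Lemma chamber_relabelM c (s t : {perm 'I_5}) :
  chamber (relabel s (relabel t c)) = chamber (relabel (s * t)%g c).
Proof. by apply: chamber_ext => i j; rewrite /relabel !permM. Qed.

(** The maximal entry is brought to position 0 1; then transpositions among
    2, 3, 4, and finally of 0 and 1, sort the entries as required by
    [chamber_of_order]. *)
Lemma exists_chamber c : gram5 c -> exists s : {perm 'I_5}, chamber (relabel s c).
Proof.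
move=> cG.
pose Q d := exists s : {perm 'I_5}, chamber (relabel s d).
have Qr (t : {perm 'I_5}) d : Q (relabel t d) -> Q d.
  by move=> [s H]; exists (s * t)%g; rewrite -chamber_relabelM.
pose P d := gram5 d /\ forall i j, i != j -> d i j <= d i0 i1.
have Pr (t : {perm 'I_5}) d :
    P d -> d (t i0) (t i1) = d i0 i1 -> P (relabel t d).
  move=> [dG dm] e; split; first exact: gram5_relabel.
  by move=> i j ij; rewrite /relabel e dm // (inj_eq perm_inj).
suff PQ d : P d -> Q d.
  have [s _ sm] := @arg_maxP _ R {perm 'I_5} 1%g xpredT (fun s => c (s i0) (s i1)) isT.
  apply: (Qr s); apply: PQ; split; first exact: gram5_relabel.
  move=> i j ij; have [t [ti tj]] := @perm_two_points _ i0 i1 i j isT ij.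
  by rewrite /relabel -ti -tj -!permM; exact: sm.
have Pt (t : {perm 'I_5}) e : P e -> t i0 = i0 -> t i1 = i1 -> P (relabel t e).
  by move=> Pe t_0 t_1; apply: Pr; rewrite // t_0 t_1.
have Q1 e : P e -> e i2 i4 <= e i3 i4 -> e i3 i4 <= e i2 i3 -> Q e.
  move=> Pe t0 tb.
  have [s0|/ltW s0] := lerP (e i1 i4) (e i0 i4).
    exists 1%g; rewrite (chamber_ext (d := e)).
      by case: Pe => eG em; exact: chamber_of_order.
    by move=> i j; rewrite /relabel !perm1.
  have [eG em] : P (relabel (tperm i0 i1) e).
    by apply: Pr => //; rewrite !permE /= (gram_sym Pe.1).
  apply: (Qr (tperm i0 i1)); exists 1%g; rewrite (chamber_ext (d := relabel (tperm i0 i1) e)).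
    by apply: chamber_of_order => //; rewrite /relabel !permE.
  by move=> i j; rewrite /relabel !perm1.
have Q2 e : P e -> e i2 i4 <= e i2 i3 -> e i3 i4 <= e i2 i3 -> Q e.
  move=> Pe h1 h2; have [t0|/ltW t0] := lerP (e i2 i4) (e i3 i4); first exact: Q1.
  by apply: (Qr (tperm i2 i3)); apply: Q1; [apply: Pt| |];
    rewrite /relabel ?permE //= ?(gram_sym Pe.1 i3 i2).
have Q3 e : P e -> e i2 i4 <= e i2 i3 -> Q e.
  move=> Pe h1; have [t0|/ltW t0] := lerP (e i3 i4) (e i2 i3); first exact: Q2.
  apply: (Qr (tperm i2 i4)); apply: Q2; [apply: Pt| |]; rewrite /relabel ?permE //=;
    rewrite ?(gram_sym Pe.1 i4 i2) ?(gram_sym Pe.1 i3 i2) ?(gram_sym Pe.1 i4 i3) //.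
  exact: le_trans t0.
move=> Pd; have [t0|/ltW t0] := lerP (d i2 i4) (d i2 i3); first exact: Q3.
by apply: (Qr (tperm i3 i4)); apply: Q3; [apply: Pt|]; rewrite /relabel ?permE //=.
Qed.

Section Top.
Variable c : 'I_5 -> 'I_5 -> R.
Hypotheses (cG : gram5 c) (cC : chamber c).

(** This is cos 72. *)
Definition golden : R := (Num.sqrt 5 - 1) / 4.
Lemma golden_gt0 : 0 < golden.
Proof.
have : 1 < Num.sqrt 5 :> R by rewrite -[X in X < _]sqrtr1 ltr_sqrt; lra.
by rewrite /golden => h; lra.
Qed.
Lemma golden_sqr : golden ^+ 2 = (1 - 2 * golden) / 4.
Proof.
have : Num.sqrt 5 ^+ 2 = 5 :> R by rewrite sqr_sqrtr //; lra.
by rewrite /golden => h; rewrite expr_div_n sqrrB h; lra.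
Qed.

(** The entries between {0, 1} and {2, 3} are at most cos 72 by [gram_path],
    the others are bounded by c 0 4 or c 3 4. *)
Lemma chamber_le_b i j : i != j -> ~~ same_pair i j i0 i1 -> c i j <= c i2 i3.
Proof.
have [[x02 x03 x12 x13] zb] := chamber_cross_le cG cC golden_gt0 golden_sqr.
have s_b := chamber_s_le cG cC; have t_b := chamber_t_le cG cC.
have /and5P[s0 t0 _ _ _] := cC.
have sym := gram_sym cG.
by elim/ord5_ind: i; elim/ord5_ind: j; rewrite /same_pair //= => _ _ //; try lra;
  rewrite sym; try lra.
Qed.

Lemma chamber_le_a i j : i != j -> c i j <= c i0 i1.
Proof.
have /and5P[_ _ ba _ _] := cC.
case: (boolP (same_pair i j i0 i1)) => [|h ij]; last first.
  exact: le_trans (chamber_le_b ij h) ba.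
by case/orP => /andP[/eqP-> /eqP->] _ //; rewrite gram_sym.
Qed.

Lemma chamber_lt_b i j : 0 < slack c -> i != j -> ~~ same_pair i j i0 i1 ->
  ~~ same_pair i j i2 i3 -> c i j < c i2 i3.
Proof.
move=> g0.
have [[x02 x03 x12 x13] zb] := chamber_cross_le cG cC golden_gt0 golden_sqr.
have /and5P[s0 t0 ba _ _] := cC.
have core : 0 < 4 * c i2 i3 ^+ 2 + 2 * c i2 i3 - 1 by move: g0; rewrite /slack; lra.
have zb' : golden < c i2 i3.
  rewrite lt_neqAle zb andbT; apply/eqP => zE; move: core.
  by rewrite -zE golden_sqr; lra.
have s_b := chamber_s_lt cG cC core.
have t_b : c i3 i4 < c i2 i3.
  rewrite lt_neqAle (chamber_t_le cG cC) andbT; apply/eqP => /(chamber_t_slack cG cC).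
  by move=> gE; rewrite gE ltxx in g0.
have sym := gram_sym cG.
by elim/ord5_ind: i; elim/ord5_ind: j; rewrite /same_pair //= => _ _ _ //; try lra;
  rewrite sym; try lra.
Qed.

Lemma chamber_s_strict : c i0 i1 < 1 -> c i1 i4 < c i0 i4.
Proof.
move=> a1; have /and5P[s0 _ _ _ _] := cC; have b0 := chamber_b_ge0 cC.
have ba := chamber_b_le_a cC.
rewrite lt_neqAle s0 andbT; apply/eqP => e.
have := chamber_s_sqr cG; rewrite e subrr expr0n mulr0.
have := chamber_tau_gt0 cG cC.
set A := _ - _ ^+ 2 => A0 E.
have : 0 < (1 - c i0 i1) * A by apply: mulr_gt0; lra.
rewrite /A; suff -> : (1 - c i0 i1) * (2 + 2 * c i0 i1 - (c i0 i1 - c i2 i3 + 1 / 2) ^+ 2) =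
   2 * (1 - c i0 i1 ^+ 2) - (c i2 i3 - c i0 i1 - 1 / 2) ^+ 2 * (1 - c i0 i1).
  by rewrite -E ltxx.
by lra.
Qed.

Lemma chamber_t_strict : c i2 i3 < 1 -> c i2 i4 < c i3 i4.
Proof.
move=> b1; have /and5P[_ t0 _ _ _] := cC; have b0 := chamber_b_ge0 cC.
have ba := chamber_b_le_a cC; have a1 := chamber_a_le1 cG.
rewrite lt_neqAle t0 andbT; apply/eqP => e.
have := chamber_t_sqr cG; rewrite e subrr expr0n mulr0.
have -> : 2 * (1 - c i2 i3 ^+ 2) - (c i0 i1 - c i2 i3 - 1 / 2) ^+ 2 * (1 - c i2 i3) =
  (1 - c i2 i3) * (2 + 2 * c i2 i3 - (c i0 i1 - c i2 i3 - 1 / 2) ^+ 2) by lra.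
have : (c i0 i1 - c i2 i3 - 1 / 2) ^+ 2 <= 1.
  have : 0 <= (1 - (c i0 i1 - c i2 i3 - 1 / 2)) * (1 + (c i0 i1 - c i2 i3 - 1 / 2)).
    by apply: mulr_ge0; lra.
  by lra.
move=> h E; have : 0 < (1 - c i2 i3) * (2 + 2 * c i2 i3 - (c i0 i1 - c i2 i3 - 1 / 2) ^+ 2).
  by apply: mulr_gt0; lra.
by rewrite -E ltxx.
Qed.

End Top.

Lemma chamber_relabel_le c (s : {perm 'I_5}) : gram5 c -> chamber c ->
  chamber (relabel s c) ->
  c (s i0) (s i1) <= c i0 i1 /\ c (s i2) (s i3) <= c i2 i3.
Proof.
move=> cG cC sC; have sN i j : i != j -> s i != s j by rewrite (inj_eq perm_inj).
split; first by apply: chamber_le_a => //; exact: sN.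
have /and5P[_ _ ba _ _] := sC; rewrite /relabel in ba.
case: (boolP (same_pair (s i0) (s i1) i0 i1)) => [h|h]; last first.
  by apply: le_trans ba _; apply: chamber_le_b => //; exact: sN.
apply: chamber_le_b => //; first exact: sN.
have := (sN i0 i2 isT, sN i0 i3 isT, sN i1 i2 isT, sN i1 i3 isT).
by move: h => /orP[] /andP[/eqP-> /eqP->] [[[n1 n2] n3] n4];
  apply/negP => /orP[] /andP[/eqP e2 /eqP e3]; move: n1 n2 n3 n4; rewrite e2 e3.
Qed.

(** The entries a and b are the two largest ones, whichever relabelling in
    the chamber is used, so [chamber_rigid] applies. *)
Lemma chamber_relabel_eq c (s : {perm 'I_5}) : gram5 c -> chamber c ->
  chamber (relabel s c) -> forall i j, c (s i) (s j) = c i j.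
Proof.
move=> cG cC sC; have sG := gram5_relabel s cG.
have [a1 b1] := chamber_relabel_le cG cC sC.
have E : chamber (relabel s^-1%g (relabel s c)).
  rewrite chamber_relabelM mulVg (chamber_ext (d := c)) //.
  by move=> i j; rewrite /relabel !perm1.
have [] := chamber_relabel_le sG sC E; rewrite /relabel !permKV => a2 b2.
by apply: (chamber_rigid sG cG sC cC); apply/eqP; rewrite eq_le ?a1 ?a2 ?b1 ?b2.
Qed.

End Chamber.

(** * Labels of the vertices of a chamber *)

(** In the applications e i j says that the edges put at the positions i and
    j by a relabelling are adjacent in the pentagon. The labels depend only on
    what distinguishes the relabellings meeting at a vertex of the chamber: the
    cyclic order 0 1 2 3 4 at P, the pairing {0, 1}, {2, 3} at Q, and at M the
    pair {0, 1} together with the opposite edge 3. *)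
Definition label_P (e : rel 'I_5) : nat := (e i0 i1 + e i1 i2 + e i2 i3 + e i3 i4 + e i4 i0)%N.
Definition label_Q (e : rel 'I_5) : nat := (e i0 i1 + e i2 i3)%N.
Definition label_M (e : rel 'I_5) : bool * nat := (e i0 i1, (e i2 i3 + e i3 i4)%N).

Definition relabel_rel (p : {perm 'I_5}) (e : rel 'I_5) : rel 'I_5 := fun i j => e (p i) (p j).

Section Chamber.
Variable R : rcfType.
Variable c : 'I_5 -> 'I_5 -> R.
Hypotheses (cG : gram5 c) (cC : chamber c).
Variable p : {perm 'I_5}.
Hypothesis cp : forall i j, c (p i) (p j) = c i j.
Variable e : rel 'I_5.
Hypothesis esym : symmetric e.

Let pN i j : i != j -> p i != p j. Proof. by rewrite (inj_eq perm_inj). Qed.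

Lemma fix_pair_01 : c i2 i3 < c i0 i1 -> same_pair (p i0) (p i1) i0 i1.
Proof.
move=> ba; apply: contraT => /(chamber_le_b cG cC (pN (i := i0) (j := i1) isT)).
by rewrite cp leNgt ba.
Qed.

(** Among the positions 2, 3, 4 the entry c 2 4 is the strictly smallest
    one. *)
Lemma fix_pair_24 : c i2 i3 < c i0 i1 -> same_pair (p i2) (p i4) i2 i4.
Proof.
move=> ba; have := fix_pair_01 ba; have a1 := chamber_a_le1 cG.
have t : c i2 i4 < c i3 i4 by apply: chamber_t_strict => //; lra.
have tb := chamber_t_le cG cC.
have := cp i2 i4; have := pN (i := i0) (j := i2) isT.
have := pN (i := i1) (j := i2) isT; have := pN (i := i0) (j := i4) isT.
have := pN (i := i1) (j := i4) isT; have := pN (i := i2) (j := i4) isT.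
have sym := gram_sym cG.
move: (p i2) (p i4); elim/ord5_ind; elim/ord5_ind => //;
  rewrite /same_pair //= => _ n1 n2 n3 n4 cE /orP[]/andP[/eqP q0 /eqP q1];
  move: n1 n2 n3 n4; rewrite q0 q1 //= => _ _ _ _; exfalso; move: cE;
  rewrite ?[c i4 _]sym ?[c i3 i2]sym; lra.
Qed.

Lemma label_M_inv : c i2 i3 < c i0 i1 -> label_M (relabel_rel p e) = label_M e.
Proof.
move=> ba; have := fix_pair_01 ba; have := fix_pair_24 ba.
have := pN (i := i0) (j := i3) isT; have := pN (i := i1) (j := i3) isT.
have := pN (i := i2) (j := i3) isT; have := pN (i := i3) (j := i4) isT.
rewrite /label_M /relabel_rel.
move: (p i3); elim/ord5_ind => n1 n2 n3 n4 /orP[]/andP[/eqP p2 /eqP p4] /orP[]/andP[/eqP p0 /eqP p1];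
  move: n1 n2 n3 n4; rewrite p0 p1 p2 p4 //= => _ _ _ _.
all: by rewrite ?(esym i1 i0) ?(esym i4 i3) ?(esym i3 i2) // addnC.
Qed.

(** Off the side opposite to Q the entries a and b exceed all others. *)
Lemma fix_pairing : 0 < slack c ->
  [&& same_pair (p i0) (p i1) i0 i1 & same_pair (p i2) (p i3) i2 i3] ||
  [&& same_pair (p i0) (p i1) i2 i3 & same_pair (p i2) (p i3) i0 i1].
Proof.
move=> g0; have /and5P[_ _ ba _ _] := cC.
have L i j : i != j -> c i2 i3 <= c i j -> same_pair i j i0 i1 || same_pair i j i2 i3.
  move=> ij h; apply: contraT; rewrite negb_or => /andP[h1 h2].
  by have := chamber_lt_b cG cC g0 ij h1 h2; rewrite ltNge h.
have := L _ _ (pN (i := i0) (j := i1) isT); rewrite cp => /(_ ba).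
have := L _ _ (pN (i := i2) (j := i3) isT); rewrite cp => /(_ (lexx _)).
have n1 := pN (i := i0) (j := i2) isT; have n2 := pN (i := i1) (j := i2) isT.
case/orP => h1; case/orP => h2; rewrite ?h1 ?h2 ?orbT //; exfalso; move: n1 n2;
  case/orP: h1 => /andP[/eqP-> _];
  by case/orP: h2 => /andP[/eqP-> /eqP->].
Qed.

Lemma label_Q_inv : 0 < slack c -> label_Q (relabel_rel p e) = label_Q e.
Proof.
move=> /fix_pairing; rewrite /label_Q /relabel_rel.
by move=> /orP[]/andP[/orP[]/andP[/eqP-> /eqP->] /orP[]/andP[/eqP-> /eqP->]];
  rewrite ?(esym i1 i0) ?(esym i3 i2) // addnC.
Qed.

(** The pairing is preserved, hence also 4, and in each pair the member that is
    closer to u_4. These are the neighbours of 4 in the cyclic order. *)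
Lemma label_P_inv_slack : 0 < slack c -> c i0 i1 < 1 -> label_P (relabel_rel p e) = label_P e.
Proof.
move=> g0 a1; have /and5P[_ _ ba _ _] := cC.
have s1 := chamber_s_strict cG cC a1.
have t1 : c i2 i4 < c i3 i4 by apply: chamber_t_strict => //; lra.
have := fix_pairing g0.
have := pN (i := i0) (j := i4) isT; have := pN (i := i1) (j := i4) isT.
have := pN (i := i2) (j := i4) isT; have := pN (i := i3) (j := i4) isT.
have := cp i0 i4; have := cp i1 i4; have := cp i2 i4; have := cp i3 i4.
rewrite /label_P /relabel_rel.
move: (p i4); elim/ord5_ind => c3 c2 c1 c0 n3 n2 n1 n0
  /orP[]/andP[/orP[]/andP[/eqP p0 /eqP p1] /orP[]/andP[/eqP p2 /eqP p3]];
  move: n0 n1 n2 n3; rewrite p0 p1 p2 p3 in c0 c1 c2 c3 * => //= _ _ _ _;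
  try (exfalso; lra).
by rewrite (esym i3 i2) (esym i2 i1) (esym i1 i0) (esym i0 i4) (esym i4 i3);
  move: (e i0 i1) (e i1 i2) (e i2 i3) (e i3 i4) (e i4 i0); clear; do 5!case.
Qed.

(** Here p preserves {0, 1}, 3 and {2, 4}. The mirror symmetry through the
    edge 3 gives c 0 2 = c 1 4 < c 0 4, so p moves 0, 1 and 2, 4 together. *)
Lemma label_P_inv_trapezoid : slack c = 0 -> c i2 i3 < c i0 i1 -> c i0 i1 < 1 ->
  label_P (relabel_rel p e) = label_P e.
Proof.
move=> g0 ba a1.
have s1 := chamber_s_strict cG cC a1.
have := fix_pair_01 ba; have := fix_pair_24 ba.
have := pN (i := i0) (j := i3) isT; have := pN (i := i1) (j := i3) isT.
have := pN (i := i2) (j := i3) isT; have := pN (i := i3) (j := i4) isT.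
have := cp i0 i4.
have := chamber_refl_q cG cC g0 i0 i2; have [-> _ -> _ _] := refl_qE.
rewrite /label_P /relabel_rel.
move: (p i3); elim/ord5_ind => cq c04 n1 n2 n3 n4
  /orP[]/andP[/eqP p2 /eqP p4] /orP[]/andP[/eqP p0 /eqP p1];
  move: n1 n2 n3 n4; rewrite p0 p1 p2 p4 in c04 * => //= _ _ _ _; try (exfalso; lra).
by rewrite (esym i1 i0) (esym i0 i4) (esym i4 i3) (esym i3 i2) (esym i2 i1);
  move: (e i0 i1) (e i1 i2) (e i2 i3) (e i3 i4) (e i4 i0); clear; do 5!case.
Qed.

(** The two mirror symmetries make c constant on adjacent pairs and on
    non-adjacent pairs, with different values. *)
Lemma label_P_inv_regular : slack c = 0 -> c i0 i1 = c i2 i3 -> c i0 i1 < 1 ->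
  label_P (relabel_rel p e) = label_P e.
Proof.
move=> g0 ba a1.
have s1 := chamber_s_strict cG cC a1.
have sym := gram_sym cG.
have [q0 q1 q2 q3 q4] := refl_qE; have [m0 m1 m2 m3 m4] := refl_mE.
have q := chamber_refl_q cG cC g0; have m := chamber_refl_m cG cC ba.
have := q i0 i4; have := q i0 i2; have := q i0 i3; have := q i2 i3.
have := m i0 i2; have := m i0 i4; have := m i1 i4; have := m i0 i1.
rewrite q0 q2 q3 q4 m0 m1 m2 m4 (sym i4 i3) (sym i3 i2) (sym i3 i1) => m01 m14 m04 m02 q23 q03 q02 q04.
have cE i j : i != j -> c i j = if pentagon_edge i j then c i0 i1 else c i1 i4.
  by elim/ord5_ind: i; elim/ord5_ind: j => // _;
    case E: (pentagon_edge _ _); move: E => // _; try lra; rewrite sym; lra.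
have K i j : pentagon_edge i j -> pentagon_edge (p i) (p j).
  move=> ij; have iNj : i != j by move: ij; elim/ord5_ind: i; elim/ord5_ind: j.
  have := cp i j; rewrite (cE (p i) (p j)) ?pN // (cE i j) // ij; case: ifP => // _ h.
  have h4 : c i0 i4 = c i0 i1 by rewrite (cE i0 i4).
  by exfalso; lra.
have := K i0 i1 isT; have := K i1 i2 isT; have := K i2 i3 isT; have := K i3 i4 isT.
have := K i4 i0 isT.
have := pN (i := i0) (j := i2) isT; have := pN (i := i1) (j := i3) isT.
have := pN (i := i2) (j := i4) isT.
have := pN (i := i0) (j := i3) isT; have := pN (i := i1) (j := i4) isT.
rewrite /label_P /relabel_rel.
move=> n14 n03 n24 n13 n02 k40 k34 k23 k12 k01.
move: (p i0) (p i1) k01 (p i2) k12 n02 (p i3) k23 n13 n03 (p i4) k34 k40 n24 n14.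
elim/ord5_ind; elim/ord5_ind => // _; elim/ord5_ind => // _ // _; elim/ord5_ind => // _ // _ // _;
  elim/ord5_ind => // _ // _ // _ // _.
all: by rewrite ?(esym i1 i0) ?(esym i0 i4) ?(esym i4 i3) ?(esym i3 i2) ?(esym i2 i1);
  move: (e i0 i1) (e i1 i2) (e i2 i3) (e i3 i4) (e i4 i0); clear; do 5!case.
Qed.

Lemma label_P_inv : c i0 i1 < 1 -> label_P (relabel_rel p e) = label_P e.
Proof.
move=> a1; have /and5P[_ _ ba _ g0] := cC.
have [g|g] := boolP (0 < slack c); first exact: label_P_inv_slack.
have g1 : slack c = 0 by apply/eqP; rewrite eq_le g0 leNgt g.
move: ba; rewrite le_eqVlt => /orP[/eqP ba|ba]; last exact: label_P_inv_trapezoid.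
exact: label_P_inv_regular.
Qed.

End Chamber.

(** * Combinatorics of the twelve chambers modulo the dihedral group *)

Section Combinatorics.
Local Open Scope nat_scope.

Definition labels (e : rel 'I_5) := (label_P e, label_Q e, label_M e).

(** The labels of the vertices P, Q, M of the twelve chambers modulo the
    dihedral group. *)
Definition triangles : seq (nat * nat * (bool * nat)) :=
  [:: (5, 2, (true, 2)); (3, 2, (true, 2)); (3, 2, (true, 1)); (2, 2, (true, 1));
      (3, 1, (true, 1)); (2, 1, (true, 1)); (3, 1, (false, 1)); (2, 1, (false, 1));
      (3, 0, (false, 1)); (2, 0, (false, 1)); (2, 0, (false, 0)); (0, 0, (false, 0))].

(** Rotations for f = false, reflections for f = true. *)
Definition dih (r : 'I_5) (f : bool) (k : 'I_5) : 'I_5 := inZp (r + (if f then 5 - k else k)).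

(** From here on relabellings are encoded by the list of their values, and
    products of the three mirror relabellings by words in 0, 1, 2, so that the
    statements about all relabellings can be checked by computation. *)
Definition adjn (a b : nat) := (b == a.+1 %% 5) || (a == b.+1 %% 5).
Definition nth0 (s : seq nat) : nat -> nat := nth 0 s.
Definition labels_list (s : seq nat) : nat * nat * (bool * nat) :=
  let e i j := adjn (nth0 s i) (nth0 s j) in
  (e 0 1 + e 1 2 + e 2 3 + e 3 4 + e 4 0, e 0 1 + e 2 3, (e 0 1, e 2 3 + e 3 4)).
Definition gen_list (g : nat) : seq nat :=
  match g with 0 => [:: 1; 0; 2; 3; 4] | 1 => [:: 1; 0; 4; 3; 2] | _ => [:: 3; 2; 1; 0; 4] end.
Definition gen_perm (g : nat) : {perm 'I_5} :=
  match g with 0 => refl_p | 1 => refl_q | _ => refl_m end.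
Definition word_list (w : seq nat) (k : nat) := foldr (fun g => nth0 (gen_list g)) k w.
Definition word_perm (w : seq nat) (k : 'I_5) : 'I_5 := foldr (fun g (k : 'I_5) => gen_perm g k) k w.
Fixpoint alternating n (x y : nat) : seq nat :=
  if n is n'.+1 then x :: alternating n' y x else [::].
(** The elements of the group generated by at most two of the involutions;
    alternating words of length at most five are enough, as the largest of these
    groups is dihedral of order ten. *)
Definition words (gs : seq nat) : seq (seq nat) :=
  match gs with
  | [:: x] => [:: [::]; [:: x]]
  | [:: x; y] => flatten [seq [:: alternating n x y; alternating n y x] | n <- iota 0 6]
  | _ => [:: [::]]
  end.
Definition dih_nat (r : nat) (f : bool) (k : nat) := (r + (if f then 5 - k else k)) %% 5.
Definition perms5 := permutations (iota 0 5).

(** The flags fp, fq, fm tell which of the vertices P, Q, M have a nonzero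
    weight. *)
Definition merge_check (fp fq fm : bool) : bool :=
  let gs := [seq g <- iota 0 3 | nth false [:: ~~ fp; ~~ fq; ~~ fm] g] in
  all (fun s => let l := labels_list s in
    all (fun s' => let l' := labels_list s' in
      if [&& fp ==> (l.1.1 == l'.1.1), fq ==> (l.1.2 == l'.1.2) & fm ==> (l.2 == l'.2)] then
      has (fun w => has (fun r => has (fun f =>
        s' == [seq dih_nat r f (nth0 s (word_list w k)) | k <- iota 0 5])
        [:: false; true]) (iota 0 5)) (words gs) else true) perms5) perms5.

Lemma merge_checkP fp fq fm : fp || fq || fm -> merge_check fp fq fm.
Proof. by case: fp; case: fq; case: fm => // _; vm_compute. Qed.

Lemma labels_check : all (fun s => labels_list s \in triangles) perms5.
Proof. by vm_compute. Qed.

Lemma triangles_check : all (fun l => has (fun s => labels_list s == l) perms5) triangles.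
Proof. by vm_compute. Qed.

Definition perm_values (s : {perm 'I_5}) : seq nat :=
  [:: val (s i0); val (s i1); val (s i2); val (s i3); val (s i4)].

Lemma perm_values_perms5 s : perm_values s \in perms5.
Proof.
rewrite mem_permutations.
have sE : perm_values s =
  [seq val i | i <- [seq s j | j <- [:: i0; i1; i2; i3; i4]]] by [].
have U : uniq (perm_values s) by rewrite sE (map_inj_uniq val_inj) (map_inj_uniq (@perm_inj _ s)).
apply: uniq_perm => //.
have [] // := @uniq_min_size _ (perm_values s) (iota 0 5) U.
by rewrite sE => _ /mapP[i _ ->]; rewrite mem_iota /= ltn_ord.
Qed.

Lemma nth_perm_values s (k : 'I_5) : nth0 (perm_values s) k = s k.
Proof. by elim/ord5_ind: k. Qed.

Lemma labels_perm_values s : labels (relabel_rel s pentagon_edge) = labels_list (perm_values s).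
Proof. by []. Qed.

Lemma labels_triangles s : labels (relabel_rel s pentagon_edge) \in triangles.
Proof. by rewrite labels_perm_values; have /allP := labels_check; apply; exact: perm_values_perms5. Qed.

Lemma triangles_labels l : l \in triangles ->
  exists s : {perm 'I_5}, labels (relabel_rel s pentagon_edge) = l.
Proof.
have /allP H := triangles_check; move=> /H /hasP[s].
rewrite mem_permutations => sP /eqP <-.
have sz : size s = 5 by rewrite (perm_size sP).
have lt i : i < 5 -> nth 0 s i < 5.
  by move=> i5; have := mem_nth 0 (s := s) (n := i); rewrite sz (perm_mem sP) mem_iota => /(_ i5).
have f_inj : injective (fun i : 'I_5 => inZp (nth 0 s i) : 'I_5).
  move=> i j /(congr1 val) /=; rewrite !modn_small ?lt //.
  by move/eqP; rewrite nth_uniq ?sz ?(perm_uniq sP) // => /eqP/val_inj.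
exists (perm f_inj); rewrite labels_perm_values; congr labels_list.
apply: (@eq_from_nth _ 0); rewrite /= ?sz //.
move=> i i5; rewrite -[nth _ _ _]/(nth0 _ (Ordinal i5)) nth_perm_values permE /=.
by rewrite modn_small ?lt.
Qed.

Lemma gen_permE g (k : 'I_5) : gen_perm g k = nth0 (gen_list g) k :> nat.
Proof.
case: refl_pE => p0 p1 p2 p3 p4; case: refl_qE => q0 q1 q2 q3 q4.
case: refl_mE => m0 m1 m2 m3 m4.
by case: g => [|[|g]] /=; elim/ord5_ind: k;
  rewrite ?(p0, p1, p2, p3, p4, q0, q1, q2, q3, q4, m0, m1, m2, m3, m4).
Qed.

Lemma word_permE w (k : 'I_5) : word_perm w k = word_list w k :> nat.
Proof. by elim: w => //= g w IH; rewrite gen_permE IH. Qed.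

Lemma words_letters fp fq fm :
  let gs := [seq g <- iota 0 3 | nth false [:: ~~ fp; ~~ fq; ~~ fm] g] in
  fp || fq || fm ->
  all (all (fun g => match g with 0 => ~~ fp | 1 => ~~ fq | 2 => ~~ fm | _ => false end)) (words gs).
Proof. by case: fp; case: fq; case: fm. Qed.

(** Two chambers modulo the dihedral group that share the vertices flagged by
    fp, fq, fm are joined by reflections in sides containing these vertices. The
    relabelling h is the product of these reflections, and its last property says
    that it fixes every matrix which they fix. *)
Lemma label_merge (s s' : {perm 'I_5}) (fp fq fm : bool) :
    let l := labels (relabel_rel s pentagon_edge) in let l' := labels (relabel_rel s' pentagon_edge) in
    fp || fq || fm ->
    (fp -> l.1.1 = l'.1.1) -> (fq -> l.1.2 = l'.1.2) -> (fm -> l.2 = l'.2) ->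
  exists (h : 'I_5 -> 'I_5) (r : 'I_5) (f : bool),
    (forall k, s' k = dih r f (s (h k))) /\
    forall (T : Type) (c : 'I_5 -> 'I_5 -> T),
      (~~ fp -> forall i j, c (refl_p i) (refl_p j) = c i j) ->
      (~~ fq -> forall i j, c (refl_q i) (refl_q j) = c i j) ->
      (~~ fm -> forall i j, c (refl_m i) (refl_m j) = c i j) ->
      forall i j, c (h i) (h j) = c i j.
Proof.
move=> l l' F ep eq em.
have /allP/(_ _ (perm_values_perms5 s))/allP/(_ _ (perm_values_perms5 s')) := merge_checkP F.
cbv zeta; rewrite -!labels_perm_values ifT; last first.
  by apply/and3P; split; apply/implyP => ?; apply/eqP; [exact: ep|exact: eq|exact: em].
move=> /hasP[w wW /hasP[r r5 /hasP[f _ /eqP E]]].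
have {}r5 : r < 5 by move: r5; rewrite mem_iota.
exists (word_perm w), (Ordinal r5), f; split => [k|T c cp cq cm].
  apply: val_inj; change (s' k = dih (Ordinal r5) f (s (word_perm w k)) :> nat).
  rewrite -(nth_perm_values s') E {1}/nth0 (nth_map 0) ?size_iota // nth_iota // add0n.
  by rewrite -word_permE nth_perm_values.
have /allP/(_ _ wW) := words_letters F.
elim: w {wW E} => //= g w IH /andP[gG wG] i j.
rewrite -[RHS](IH wG).
by case: g gG => [|[|[|g]]] //= h; [exact: cp | exact: cq | exact: cm].
Qed.

End Combinatorics.

(** * A square triangulated by twelve triangles *)

Section Planar.
Variable R : realFieldType.

(** The eleven vertices are placed so that exchanging adjacent and
    non-adjacent edges (as between the pentagon and the pentagram) becomes the
    symmetry z -> - z. Going round the boundary of the square one meets P, Q, P, M,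
    P, Q, P, M; the other Q is the centre, and the other two M are on the vertical
    axis. *)
Definition pos_P (n : nat) : R * R :=
  match n with 5%N => (-1, 1) | 3%N => (-1, 0) | 2%N => (1, 0) | _ => (1, -1) end.
Definition pos_Q (n : nat) : R * R :=
  match n with 2%N => (1, 1) | 1%N => (0, 0) | _ => (-1, -1) end.
Definition pos_M (l : bool * nat) : R * R :=
  match l with
  | (true, 2%N) => (-1, 1 / 2) | (true, _) => (0, 1 / 4)
  | (false, 0%N) => (1, - (1 / 2)) | (false, _) => (0, - (1 / 4)) end.

Definition bary (l : nat * nat * (bool * nat)) (p q m : R) : R * R :=
  (p * (pos_P l.1.1).1 + q * (pos_Q l.1.2).1 + m * (pos_M l.2).1,
   p * (pos_P l.1.1).2 + q * (pos_Q l.1.2).2 + m * (pos_M l.2).2).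

Definition simplex (p q m : R) := [/\ 0 <= p, 0 <= q, 0 <= m & p + q + m = 1].

(** Comparison of weights p, p' carried by vertices with labels x, x'. *)
Definition agree (T : eqType) (x x' : T) (p p' : R) :=
  (x == x' -> p = p') /\ (x != x' -> p = 0 /\ p' = 0).

Lemma agree_sym (T : eqType) (x x' : T) p p' : agree x x' p p' -> agree x' x p' p.
Proof.
by rewrite /agree eq_sym => -[a b]; split=> [/a|/b []].
Qed.

(** Two triangles meet only along common faces. For each pair of triangles this
    is a statement of linear arithmetic. *)
Lemma bary_inj l l' p q m p' q' m' : l \in triangles -> l' \in triangles ->
  simplex p q m -> simplex p' q' m' -> bary l p q m = bary l' p' q' m' ->
  [/\ agree l.1.1 l'.1.1 p p', agree l.1.2 l'.1.2 q q' & agree l.2 l'.2 m m'].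
Proof.
wlog : l l' p q m p' q' m' / (index l triangles <= index l' triangles)%N.
  move=> H lT l'T S S' E; case/orP: (leq_total (index l triangles) (index l' triangles)) => h.
    exact: H.
  by have [a b d] := H _ _ _ _ _ _ _ _ h l'T lT S' S (esym E); split; exact: agree_sym.
move=> ll; rewrite !inE => lT l'T; move: ll.
case: l lT => [[lp lq] lm]; case: l' l'T => [[lp' lq'] lm'].
by do ![case/orP] => /eqP[-> -> ->]; do ![case/orP] => /eqP[-> -> ->] // _;
  rewrite /bary /= => -[p0 q0 m0 s] [p0' q0' m0' s'] [ex ey];
  rewrite /agree; split; (split=> // _; (lra || (split; lra))).
Qed.

Definition compl (l : nat * nat * (bool * nat)) : nat * nat * (bool * nat) :=
  ((5 - l.1.1)%N, (2 - l.1.2)%N, (~~ l.2.1, (2 - l.2.2)%N)).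

Lemma compl_triangles l : l \in triangles -> compl l \in triangles.
Proof. by rewrite !inE; do ![case/orP] => /eqP ->. Qed.

Lemma bary_compl l p q m : l \in triangles ->
  bary (compl l) p q m = (- (bary l p q m).1, - (bary l p q m).2).
Proof.
by rewrite !inE; do ![case/orP] => /eqP ->; rewrite /bary /=; congr pair; lra.
Qed.

(** The upper half of the square consists of six triangles, bounded by lines
    through (1, 1) and by the lines from (0, 1 / 4) to (-1, 0), (0, 0)
    and (1, 0). *)
Lemma bary_surj x y : -1 <= x <= 1 -> -1 <= y <= 1 ->
  exists l p q m, [/\ l \in triangles, simplex p q m & bary l p q m = (x, y)].
Proof.
wlog y0 : x y / 0 <= y => [H hx hy|].
  have [y0|/ltW y0] := lerP 0 y; first exact: H.
  have [||| l [p [q [m [lT S E]]]]] := H (- x) (- y); try lra.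
  exists (compl l), p, q, m; split => //; first exact: compl_triangles.
  by rewrite bary_compl // E /= !opprK.
move=> /andP[x1 x2] /andP[y1 y2].
have [h1|h1] := lerP (3 / 4 + x / 4) y.
  exists (5%N, 2%N, (true, 2%N)), ((1 - x) / 2 - 2 + 2 * y), ((1 + x) / 2), (2 * (1 - y)).
  by split => //; [split; lra | rewrite /bary /=; congr pair; lra].
have [h2|h2] := lerP ((x + 1) / 2) y.
  exists (3%N, 2%N, (true, 2%N)), (1 - (1 + x) / 2 - (2 * y - 1 - x)), ((1 + x) / 2), (2 * y - 1 - x).
  by split => //; [split; lra | rewrite /bary /=; congr pair; lra].
have [h3|h3] := lerP (1 / 4 + 3 / 4 * x) y.
  have [h4|h4] := lerP ((x + 1) / 4) y.
    exists (3%N, 2%N, (true, 1%N)),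
      (2 * y - 1 / 2 - 3 / 2 * x), (2 * y - 1 / 2 - x / 2), (2 - 4 * y + 2 * x).
    by split => //; [split; lra | rewrite /bary /=; congr pair; lra].
  have [h5|h5] := lerP x 0.
    exists (3%N, 1%N, (true, 1%N)), (- x), (1 + x - 4 * y), (4 * y).
    by split => //; [split; lra | rewrite /bary /=; congr pair; lra].
  exfalso; lra.
have [h4|h4] := lerP ((1 - x) / 4) y.
  exists (2%N, 2%N, (true, 1%N)), (x - (y - (1 - x) / 4)), (y - (1 - x) / 4), (1 - x).
  by split => //; [split; lra | rewrite /bary /=; congr pair; lra].
have [h5|h5] := lerP x 0.
  exists (3%N, 1%N, (true, 1%N)), (- x), (1 + x - 4 * y), (4 * y).
  by split => //; [split; lra | rewrite /bary /=; congr pair; lra].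
exists (2%N, 1%N, (true, 1%N)), x, (1 - x - 4 * y), (4 * y).
by split => //; [split; lra | rewrite /bary /=; congr pair; lra].
Qed.

Lemma bary_square l p q m : l \in triangles -> simplex p q m ->
  -1 <= (bary l p q m).1 <= 1 /\ -1 <= (bary l p q m).2 <= 1.
Proof.
by rewrite !inE => + [p0 q0 m0 s]; do ![case/orP] => /eqP ->; rewrite /bary /=; lra.
Qed.

End Planar.

(** * The map from Gram matrices to the square *)

Lemma labels_ext (e e' : rel 'I_5) : (forall i j, e i j = e' i j) -> labels e = labels e'.
Proof. by move=> E; rewrite /labels /label_P /label_Q /label_M !E. Qed.

Section SquareImage.
Variable R : rcfType.
Implicit Types (c d : 'I_5 -> 'I_5 -> R).

Definition weight_sum c := 1 - c i2 i3 + slack c.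
Definition weight_P c := (1 - c i0 i1) / weight_sum c.
Definition weight_Q c := slack c / weight_sum c.
Definition weight_M c := (c i0 i1 - c i2 i3) / weight_sum c.

Lemma weight_sum_gt0 c : gram5 c -> chamber c -> 0 < weight_sum c.
Proof.
move=> cG /and5P[_ _ ba b0 g0]; have a1 := chamber_a_le1 cG.
rewrite /weight_sum; have [b1|b1] := ltrP (c i2 i3) 1; first by lra.
have eb : c i2 i3 = 1 by lra.
by rewrite /slack eb; lra.
Qed.

Lemma weights_simplex c : gram5 c -> chamber c ->
  simplex (weight_P c) (weight_Q c) (weight_M c).
Proof.
move=> cG cC; have T := weight_sum_gt0 cG cC; have a1 := chamber_a_le1 cG.
have /and5P[_ _ ba b0 g0] := cC.
rewrite /weight_P /weight_Q /weight_M; split.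
- by rewrite divr_ge0 ?subr_ge0 // ltW.
- by rewrite divr_ge0 // ltW.
- by rewrite divr_ge0 ?subr_ge0 // ltW.
have T0 : weight_sum c != 0 by rewrite gt_eqF.
by rewrite -[RHS](divff T0) -!mulrDl /weight_sum; congr (_ / _); lra.
Qed.

(** Both t and u are roots of 4 r^2 t^2 - (11 r + 1 - 2 p) t + 5. Distinct roots
    satisfy 4 r (r t + r u) = 11 r + 1 - 2 p, which exceeds 8 r. *)
Lemma weight_sum_unique (p r t u : R) : 0 <= r -> p <= r -> 0 <= 1 - r * t -> 0 <= 1 - r * u ->
  t = 1 - (1 - r * t) + (4 * (1 - r * t) ^+ 2 + 4 * (1 - r * t) - 1 - 2 * (1 - p * t)) ->
  u = 1 - (1 - r * u) + (4 * (1 - r * u) ^+ 2 + 4 * (1 - r * u) - 1 - 2 * (1 - p * u)) ->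
  t = u.
Proof.
move=> r0 pr rt ru Et Eu.
have Z : (t - u) * (4 * r * (r * t + r * u) - (11 * r + 1 - 2 * p)) = 0.
  have -> : (t - u) * (4 * r * (r * t + r * u) - (11 * r + 1 - 2 * p)) =
    (1 - (1 - r * t) + (4 * (1 - r * t) ^+ 2 + 4 * (1 - r * t) - 1 - 2 * (1 - p * t)) - t)
   - (1 - (1 - r * u) + (4 * (1 - r * u) ^+ 2 + 4 * (1 - r * u) - 1 - 2 * (1 - p * u)) - u).
    by lra.
  by rewrite -Et -Eu !subrr.
have N : 4 * r * (r * t + r * u) <= 4 * r * 2 by apply: ler_wpM2l; lra.
by move/eqP: Z; rewrite mulf_eq0 => /orP[/eqP|/eqP] Z; lra.
Qed.

(** Given the weights, a and b are affine functions of the sum of the three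
    slacks, which solves a quadratic equation. *)
Lemma weights_inj c d : gram5 c -> gram5 d -> chamber c -> chamber d ->
  weight_P c = weight_P d -> weight_M c = weight_M d ->
  c i0 i1 = d i0 i1 /\ c i2 i3 = d i2 i3.
Proof.
move=> cG dG cC dC eP eM.
have [p0 q0 m0 s1] := weights_simplex cG cC.
have Tc := weight_sum_gt0 cG cC; have Td := weight_sum_gt0 dG dC.
have Tc0 : weight_sum c != 0 by rewrite gt_eqF.
have Td0 : weight_sum d != 0 by rewrite gt_eqF.
set p := weight_P c in eP p0 s1; set m := weight_M c in eM m0 s1.
have pc : p * weight_sum c = 1 - c i0 i1 by rewrite /p /weight_P divfK.
have pd : p * weight_sum d = 1 - d i0 i1 by rewrite eP /weight_P divfK.
have mc : m * weight_sum c = c i0 i1 - c i2 i3 by rewrite /m /weight_M divfK.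
have md : m * weight_sum d = d i0 i1 - d i2 i3 by rewrite eM /weight_M divfK.
clearbody p m.
have ac : c i0 i1 = 1 - p * weight_sum c by lra.
have ad : d i0 i1 = 1 - p * weight_sum d by lra.
have bc : c i2 i3 = 1 - (p + m) * weight_sum c by lra.
have bd : d i2 i3 = 1 - (p + m) * weight_sum d by lra.
have bc0 := chamber_b_ge0 cC; have bd0 := chamber_b_ge0 dC.
have Ec : weight_sum c = 1 - c i2 i3 + (4 * c i2 i3 ^+ 2 + 4 * c i2 i3 - 1 - 2 * c i0 i1) by [].
have Ed : weight_sum d = 1 - d i2 i3 + (4 * d i2 i3 ^+ 2 + 4 * d i2 i3 - 1 - 2 * d i0 i1) by [].
rewrite ac bc in Ec; rewrite ad bd in Ed; rewrite bc in bc0; rewrite bd in bd0.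
suff E : weight_sum c = weight_sum d by rewrite ac ad bc bd E.
by apply: (@weight_sum_unique p (p + m)); lra.
Qed.

Lemma weights_surj (p q m : R) : simplex p q m ->
  exists a b : R, [/\ 0 <= b, b <= a, a <= 1 &
    let g := 4 * b ^+ 2 + 4 * b - 1 - 2 * a in let t := 1 - b + g in
    [/\ 0 <= g, 0 < t, 1 - a = p * t, g = q * t & a - b = m * t]].
Proof.
move=> [p0 q0 m0 s1]; set r := p + m; set B := 11 * r + 1 - 2 * p.
have r0 : 0 <= r by rewrite /r; lra.
have r1 : r <= 1 by rewrite /r; lra.
have B9 : 9 * r + 1 <= B by rewrite /B /r; lra.
have D0 : 0 <= B ^+ 2 - 80 * r ^+ 2.
  rewrite subr_ge0; apply: (@le_trans _ _ ((9 * r) ^+ 2)).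
    by rewrite exprMn ler_wpM2r ?sqr_ge0 //; lra.
  by rewrite ler_pXn2r // ?nnegrE; lra.
set S := Num.sqrt (B ^+ 2 - 80 * r ^+ 2).
have S0 : 0 <= S := sqrtr_ge0 _.
have SE : S ^+ 2 = B ^+ 2 - 80 * r ^+ 2 by rewrite sqr_sqrtr.
have BS : B + S != 0 by rewrite gt_eqF //; lra.
(* The smaller root of 4 r^2 t^2 - B t + 5, in a form that allows r = 0. *)
pose t := 10 / (B + S).
have t0 : 0 < t by rewrite divr_gt0 //; lra.
have rt : r * t <= 1.
  by rewrite mulrA ler_pdivrMr; lra.
have tE : 4 * r ^+ 2 * t ^+ 2 - B * t + 5 = 0.
  apply: (mulIf (x := (B + S) ^+ 2)); first by rewrite sqrf_eq0.
  have tBS : t * (B + S) = 10 by rewrite /t divfK.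
  rewrite mul0r; transitivity (4 * r ^+ 2 * (t * (B + S)) ^+ 2 -
    B * (t * (B + S)) * (B + S) + 5 * (B + S) ^+ 2); first by lra.
  by rewrite tBS; lra.
have gE : 4 * (1 - r * t) ^+ 2 + 4 * (1 - r * t) - 1 - 2 * (1 - p * t) = q * t.
  have -> : q = 1 - r by rewrite /r; lra.
  apply/eqP; rewrite -subr_eq0; apply/eqP.
  by rewrite -[RHS]tE /B; lra.
have wE : 1 - (1 - r * t) + q * t = t.
  have -> : q = 1 - r by rewrite /r; lra.
  by lra.
have pt : 0 <= p * t by rewrite mulr_ge0 // ltW.
have mt : 0 <= m * t by rewrite mulr_ge0 // ltW.
have rE : r * t = p * t + m * t by rewrite /r mulrDl.
clearbody r t; exists (1 - p * t), (1 - r * t); split; [lra | lra | lra |].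
cbv zeta; rewrite gE wE; split => //; [by rewrite mulr_ge0 // ltW | lra | lra].
Qed.

(** The triangle with sides x, y, 1 is drawn with u_4 = (-1, 0) and
    u_0 + u_1 = (x, tau), and isosceles triangles with legs 1 are erected on its
    two other sides. *)
Lemma chamber_build (a b : R) : 0 <= b -> b <= a -> a <= 1 ->
  0 <= 4 * b ^+ 2 + 4 * b - 1 - 2 * a ->
  exists c, [/\ gram5 c, chamber c, c i0 i1 = a & c i2 i3 = b].
Proof.
move=> b0 ba a1 g0; set x := a - b + 1 / 2.
have T0 : 0 <= 2 + 2 * a - x ^+ 2.
  have : x * x <= (3 / 2) * x by apply: ler_wpM2r; rewrite /x; lra.
  by rewrite /x expr2; lra.
set tau := Num.sqrt (2 + 2 * a - x ^+ 2).
have tau0 : 0 <= tau := sqrtr_ge0 _.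
have tauE : tau ^+ 2 = 2 + 2 * a - x ^+ 2 by rewrite sqr_sqrtr.
set k := Num.sqrt ((1 - a) / (1 + a)) / 2.
set h := Num.sqrt ((1 - b) / (1 + b)) / 2.
have k0 : 0 <= k by rewrite divr_ge0 ?sqrtr_ge0.
have h0 : 0 <= h by rewrite divr_ge0 ?sqrtr_ge0.
have kE : 4 * (1 + a) * k ^+ 2 = 1 - a.
  rewrite /k expr_div_n sqr_sqrtr; last by apply: divr_ge0; lra.
  have := divfK (_ : 1 + a != 0) (1 - a); set y := _ / _ => /(_ _) yE.
  have {}yE : y * (1 + a) = 1 - a by apply: yE; lra.
  lra.
have hE : 4 * (1 + b) * h ^+ 2 = 1 - b.
  rewrite /h expr_div_n sqr_sqrtr; last by apply: divr_ge0; lra.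
  have := divfK (_ : 1 + b != 0) (1 - b); set y := _ / _ => /(_ _) yE.
  have {}yE : y * (1 + b) = 1 - b by apply: yE; lra.
  lra.
pose X (i : 'I_5) : R := nth 0 [:: x / 2 - k * tau; x / 2 + k * tau;
   (1 - x) / 2 + h * tau; (1 - x) / 2 - h * tau; -1] i.
pose Y (i : 'I_5) : R := nth 0 [:: tau / 2 + k * x; tau / 2 - k * x;
   - tau / 2 + h * (1 - x); - tau / 2 - h * (1 - x); 0] i.
exists (fun i j => X i * X j + Y i * Y j).
have UU : x ^+ 2 + tau ^+ 2 = 2 + 2 * a by rewrite tauE; lra.
have VV : (1 - x) ^+ 2 + tau ^+ 2 = 2 + 2 * b by rewrite tauE /x; lra.
have ktau : 0 <= k * tau by rewrite mulr_ge0.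
have htau : 0 <= h * tau by rewrite mulr_ge0.
have e01 : X i0 * X i1 + Y i0 * Y i1 = a.
  transitivity ((1 / 4 - k ^+ 2) * (x ^+ 2 + tau ^+ 2)); first by rewrite /X /Y /=; lra.
  by rewrite UU; transitivity ((1 + a) / 2 - (4 * (1 + a) * k ^+ 2) / 2); [|rewrite kE]; lra.
have e23 : X i2 * X i3 + Y i2 * Y i3 = b.
  transitivity ((1 / 4 - h ^+ 2) * ((1 - x) ^+ 2 + tau ^+ 2)); first by rewrite /X /Y /=; lra.
  by rewrite VV; transitivity ((1 + b) / 2 - (4 * (1 + b) * h ^+ 2) / 2); [|rewrite hE]; lra.
have uk : (1 / 4 + k ^+ 2) * (x ^+ 2 + tau ^+ 2) = 1.
  by rewrite UU; transitivity ((1 + a) / 2 + (4 * (1 + a) * k ^+ 2) / 2); [|rewrite kE]; lra.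
have uh : (1 / 4 + h ^+ 2) * ((1 - x) ^+ 2 + tau ^+ 2) = 1.
  by rewrite VV; transitivity ((1 + b) / 2 + (4 * (1 + b) * h ^+ 2) / 2); [|rewrite hE]; lra.
split=> //.
- exists X, Y; split => //; rewrite ?sum5 /X /Y /=; try by lra.
  by elim/ord5_ind => /=; [rewrite -[RHS]uk | rewrite -[RHS]uk |
    rewrite -[RHS]uh | rewrite -[RHS]uh | ]; lra.
- by rewrite /chamber /slack e01 e23 b0 ba g0 /X /Y /=; lra.
Qed.

Definition chamber_image (s : {perm 'I_5}) c : R * R :=
  bary (labels (relabel_rel s pentagon_edge)) (weight_P (relabel s c))
    (weight_Q (relabel s c)) (weight_M (relabel s c)).

Lemma weights_ext c d : (forall i j, c i j = d i j) ->
  [/\ weight_P c = weight_P d, weight_Q c = weight_Q d & weight_M c = weight_M d].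
Proof. by move=> e; rewrite /weight_P /weight_Q /weight_M /weight_sum /slack !e. Qed.

(** A label matters only if its weight is nonzero. *)
Lemma bary_ext l l' (p q m : R) : 0 <= p -> 0 <= q -> 0 <= m ->
  (0 < p -> l.1.1 = l'.1.1) -> (0 < q -> l.1.2 = l'.1.2) -> (0 < m -> l.2 = l'.2) ->
  bary l p q m = bary l' p q m.
Proof.
move=> p0 q0 m0 eP eQ eM; rewrite /bary.
have E (T : Type) (pos : T -> R * R) (x x' : T) w : 0 <= w -> (0 < w -> x = x') ->
    w * (pos x).1 = w * (pos x').1 /\ w * (pos x).2 = w * (pos x').2.
  by rewrite le_eqVlt => /orP[/eqP<-|w0 /(_ w0)->//]; rewrite !mul0r.
have [-> ->] := E _ (pos_P R) _ _ _ p0 eP; have [-> ->] := E _ (pos_Q R) _ _ _ q0 eQ.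
by have [-> ->] := E _ (pos_M R) _ _ _ m0 eM.
Qed.

(** Both relabellings of c are the same matrix w, so that t is a symmetry of w
    and preserves the labels of nonzero weight. *)
Lemma chamber_image_agree c (s s' : {perm 'I_5}) : gram5 c ->
  chamber (relabel s c) -> chamber (relabel s' c) ->
  chamber_image s c = chamber_image s' c.
Proof.
move=> cG sC s'C; set w := relabel s c.
have wG : gram5 w := gram5_relabel s cG.
pose t := (s' * s^-1)%g.
have tE i : s (t i) = s' i by rewrite /t permM permKV.
have wt i j : w (t i) (t j) = w i j.
  apply: (chamber_relabel_eq wG sC); rewrite chamber_relabelM.
  by rewrite (chamber_ext (d := relabel s' c)) // => k l; rewrite /relabel ![(t * s)%g _]permM !tE.
have [eP eQ eM] : [/\ weight_P w = weight_P (relabel s' c), weight_Q w = weight_Q (relabel s' c)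
    & weight_M w = weight_M (relabel s' c)].
  by apply: weights_ext => i j; rewrite -wt /w /relabel !tE.
rewrite /chamber_image -eP -eQ -eM -/w.
have [p0 q0 m0 _] := weights_simplex wG sC.
have T := weight_sum_gt0 wG sC.
have pullE : labels (relabel_rel s' pentagon_edge) =
    labels (relabel_rel t (relabel_rel s pentagon_edge)).
  by apply: labels_ext => i j; rewrite /relabel_rel !tE.
have esym : symmetric (relabel_rel s pentagon_edge).
  by move=> i j; rewrite /relabel_rel pentagon_edge_sym.
apply: bary_ext => //; rewrite pullE.
- rewrite pmulr_lgt0 ?invr_gt0 // subr_gt0 => ?.
  by rewrite [RHS](label_P_inv wG sC wt).
- rewrite pmulr_lgt0 ?invr_gt0 // => ?.
  by rewrite [RHS](label_Q_inv wG sC wt).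
- rewrite pmulr_lgt0 ?invr_gt0 // subr_gt0 => ?.
  by rewrite [RHS](label_M_inv wG sC wt).
Qed.

Definition square_image c : R * R :=
  chamber_image (odflt 1%g [pick s : {perm 'I_5} | chamber (relabel s c)]) c.

Lemma square_imageE c (s : {perm 'I_5}) :
  gram5 c -> chamber (relabel s c) -> square_image c = chamber_image s c.
Proof.
move=> cG sC; rewrite /square_image; case: pickP => [s' /= h|/(_ s)]; last by rewrite sC.
exact: chamber_image_agree.
Qed.

Lemma square_image_relabel c (d : {perm 'I_5}) : gram5 c ->
  (forall i j, pentagon_edge (d i) (d j) = pentagon_edge i j) ->
  square_image (relabel d c) = square_image c.
Proof.
move=> cG dE; have dG := gram5_relabel d cG.
have [s sC] := exists_chamber dG; rewrite (square_imageE dG sC).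
have sdC : chamber (relabel (s * d)%g c) by rewrite -chamber_relabelM.
rewrite (square_imageE cG sdC) /chamber_image.
have [-> -> ->] : [/\ weight_P (relabel s (relabel d c)) = weight_P (relabel (s * d)%g c),
   weight_Q (relabel s (relabel d c)) = weight_Q (relabel (s * d)%g c)
    & weight_M (relabel s (relabel d c)) = weight_M (relabel (s * d)%g c)].
  by apply: weights_ext => i j; rewrite /relabel !permM.
by congr bary; apply: labels_ext => i j; rewrite /relabel_rel !permM dE.
Qed.

Lemma square_image_bound c : gram5 c -> -1 <= (square_image c).1 <= 1 /\ -1 <= (square_image c).2 <= 1.
Proof.
move=> cG; have [s sC] := exists_chamber cG; rewrite (square_imageE cG sC).
apply: bary_square; first exact: labels_triangles.
by apply: weights_simplex => //; exact: gram5_relabel.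
Qed.

(** Equal points of the square have equal weights and, where the weights are
    nonzero, equal labels. The weights give the same matrix w in the chamber, and
    [label_merge] compares the relabellings. *)
Lemma square_image_inj c c' : gram5 c -> gram5 c' -> square_image c = square_image c' ->
  exists r f, forall i j, c' (dih r f i) (dih r f j) = c i j.
Proof.
move=> cG c'G; have [s sC] := exists_chamber cG; have [s' s'C] := exists_chamber c'G.
rewrite (square_imageE cG sC) (square_imageE c'G s'C) => E.
have wG := gram5_relabel s cG; have w'G := gram5_relabel s' c'G.
have S := weights_simplex wG sC; have S' := weights_simplex w'G s'C.
have [aP aQ aM] := bary_inj (labels_triangles s) (labels_triangles s') S S' E.
set w := relabel s c in wG sC S aP aQ aM E *; set w' := relabel s' c' in w'G s'C S' aP aQ aM E *.
have eq_weight (T : eqType) (x x' : T) (p p' : R) : agree x x' p p' -> p = p'.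
  by case; case: eqP => // _ h h'; [exact: h | have [//|-> ->] := h'].
have [ea eb] := weights_inj wG w'G sC s'C (eq_weight _ _ _ _ _ aP) (eq_weight _ _ _ _ _ aM).
have ww' := chamber_rigid wG w'G sC s'C ea eb.
have T := weight_sum_gt0 wG sC.
have lab_eq (U : eqType) (x x' : U) (p p' : R) : agree x x' p p' -> p != 0 -> x = x'.
  by case=> _; case: eqP => // _ /(_ isT)[->]; rewrite eqxx.
have [|h [r [f [hE hinv]]]] := @label_merge s s' (weight_P w != 0) (weight_Q w != 0)
    (weight_M w != 0) _ (lab_eq _ _ _ _ _ aP) (lab_eq _ _ _ _ _ aQ) (lab_eq _ _ _ _ _ aM).
  case: S => _ _ _; case: eqP => //= ->; case: eqP => //= ->; case: eqP => //= -> /eqP.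
  by rewrite !addr0 eq_sym oner_eq0.
have T0 : weight_sum w != 0 by rewrite gt_eqF.
have fP : ~~ (weight_P w != 0) -> w i0 i1 = 1.
  by rewrite negbK mulf_eq0 invr_eq0 (negPf T0) orbF subr_eq0 => /eqP.
have fQ : ~~ (weight_Q w != 0) -> slack w = 0.
  by rewrite negbK mulf_eq0 invr_eq0 (negPf T0) orbF => /eqP.
have fM : ~~ (weight_M w != 0) -> w i0 i1 = w i2 i3.
  by rewrite negbK mulf_eq0 invr_eq0 (negPf T0) orbF subr_eq0 => /eqP.
have wh := hinv _ w (fun n => chamber_refl_p wG (fP n))
  (fun n => chamber_refl_q wG sC (fQ n)) (fun n => chamber_refl_m wG sC (fM n)).
have h_inj : injective h.
  by move=> i j hij; apply: (@perm_inj _ s'); rewrite !hE hij.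
have [g _ gK] := injF_bij h_inj.
exists r, f => i j.
have sh k : k = s (h (g (s^-1%g k))) by rewrite gK permKV.
by rewrite (sh i) (sh j) -!hE -[LHS]/(w' _ _) -ww' -[RHS]/(w _ _) wh.
Qed.

Lemma square_image_surj x y : -1 <= x <= 1 -> -1 <= y <= 1 ->
  exists c, gram5 c /\ square_image c = (x, y).
Proof.
move=> hx hy; have [l [p [q [m [lT S E]]]]] := bary_surj hx hy.
have [s sl] := triangles_labels lT.
have [a [b [b0 ba a1 [g0 t0 eP eQ eM]]]] := weights_surj S.
have [w [wG wC wa wb]] := chamber_build b0 ba a1 g0.
have G := gram5_relabel s^-1%g wG.
have wE i j : relabel s (relabel s^-1%g w) i j = w i j by rewrite /relabel !permK.
exists (relabel s^-1%g w); split => //.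
have sC : chamber (relabel s (relabel s^-1%g w)) by rewrite (chamber_ext wE).
have [wP wQ wM] := weights_ext wE.
have tE : weight_sum w = 1 - b + (4 * b ^+ 2 + 4 * b - 1 - 2 * a) by rewrite /weight_sum /slack wa wb.
have tN : 1 - b + (4 * b ^+ 2 + 4 * b - 1 - 2 * a) != 0 by rewrite gt_eqF.
have pE : weight_P w = p by rewrite /weight_P tE wa eP mulfK.
have qE : weight_Q w = q by rewrite /weight_Q tE /slack wa wb [X in X / _]eQ mulfK.
have mE : weight_M w = m by rewrite /weight_M tE wa wb eM mulfK.
by rewrite (square_imageE G sC) /chamber_image sl wP wQ wM pE qE mE.
Qed.

End SquareImage.

(** * Configurations and their Gram matrices *)

Section Geometry.
Variable R : realType.
Local Open Scope classical_set_scope.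
Local Open Scope quotient_scope.

Let j0 : 'I_2 := ord0.
Let j1 : 'I_2 := lift ord0 ord0.

Lemma enorm_sqr (u : 'rV[R]_2) : enorm u ^+ 2 = u ord0 j0 ^+ 2 + u ord0 j1 ^+ 2.
Proof.
rewrite /enorm !big_ord_recl big_ord0 addr0 sqr_sqrtr //.
by rewrite addr_ge0 // sqr_ge0.
Qed.

Lemma enorm_ge0 (u : 'rV[R]_2) : 0 <= enorm u.
Proof. exact: sqrtr_ge0. Qed.

Lemma enorm_eq (u v : 'rV[R]_2) : (enorm u == enorm v) = (enorm u ^+ 2 == enorm v ^+ 2).
Proof. by rewrite eqrXn2 ?enorm_ge0. Qed.

Variables (l : R) (l_gt0 : 0 < l).
Implicit Types x y : 'I_5 -> 'rV[R]_2.

Definition sqd x (i j : 'I_5) := edist (x i) (x j) ^+ 2.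

(** The product of two edges, polarized so that it only involves the
    distances between vertices. *)
Definition cgram x (i j : 'I_5) : R :=
  (sqd x (ordS i) j + sqd x i (ordS j) - sqd x (ordS i) (ordS j) - sqd x i j) / (2 * l ^+ 2).

Definition side_coord x (k : 'I_2) (i : 'I_5) : R := (x (ordS i) ord0 k - x i ord0 k) / l.

Let l_neq0 : l != 0. Proof. by rewrite gt_eqF. Qed.

Lemma cgram_dot x i j : cgram x i j =
  side_coord x j0 i * side_coord x j0 j + side_coord x j1 i * side_coord x j1 j.
Proof.
rewrite /cgram /sqd /edist !enorm_sqr !mxE /side_coord !mulf_div -mulrDl -expr2.
have two : 2 != 0 :> R by rewrite pnatr_eq0.
by rewrite -[RHS]mul1r -(divff two) mulf_div; congr (_ / _); lra.
Qed.

Lemma pentagon_edgeS i : pentagon_edge i (ordS i).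
Proof. by rewrite /pentagon_edge eqxx. Qed.

Lemma conf_edge x : conf_space (pentagon l_gt0) x <-> forall i, edist (x i) (x (ordS i)) = l.
Proof.
split=> [H i|H i j]; first by apply: H; exact: pentagon_edgeS.
have edistC p q : edist p q = edist q p :> R.
  by apply/eqP; rewrite /edist enorm_eq !enorm_sqr !mxE; apply/eqP; lra.
by rewrite /= /pentagon_edge => /orP[] /eqP -> //; rewrite edistC.
Qed.

Lemma sum_ordS (F : 'I_5 -> R) : \sum_i F (ordS i) = \sum_i F i.
Proof. by rewrite [RHS](reindex_inj (@ordS_inj 5)). Qed.

Lemma cgram_gram5 x : conf_space (pentagon l_gt0) x -> gram5 (cgram x).
Proof.
move=> /conf_edge H; exists (side_coord x j0), (side_coord x j1); split.
- exact: cgram_dot.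
- move=> i; rewrite cgram_dot.
  have : (edist (x i) (x (ordS i))) ^+ 2 = l ^+ 2 by rewrite H.
  rewrite /edist enorm_sqr !mxE /side_coord => E.
  have ll : l ^+ 2 != 0 by rewrite sqrf_eq0.
  by rewrite !mulf_div -mulrDl -[l * l]expr2 -[RHS](divff ll); congr (_ / _); rewrite -E; lra.
- by rewrite /side_coord -mulr_suml sumrB (sum_ordS (fun i => x i ord0 j0)) subrr mul0r.
- by rewrite /side_coord -mulr_suml sumrB (sum_ordS (fun i => x i ord0 j1)) subrr mul0r.
Qed.

Lemma cgram_isom x y : (forall i j, edist (y i) (y j) = edist (x i) (x j)) ->
  cgram y = cgram x.
Proof. by move=> H; do 2!apply/funext => ?; rewrite /cgram /sqd !H. Qed.

Lemma rv2E (u v : 'rV[R]_2) : u ord0 j0 = v ord0 j0 -> u ord0 j1 = v ord0 j1 -> u = v.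
Proof.
move=> h0 h1; apply/rowP; case=> [[|[|//]] Hi].
  by rewrite (_ : Ordinal _ = j0) //; exact: val_inj.
by rewrite (_ : Ordinal _ = j1) //; exact: val_inj.
Qed.

Lemma det2 (M : 'M[R]_2) : \det M = M j0 j0 * M j1 j1 - M j0 j1 * M j1 j0.
Proof.
rewrite (expand_det_row _ j0) !big_ord_recl big_ord0 addr0 /cofactor !det_mx11 !mxE /=.
rewrite expr0 expr1 mul1r mulN1r mulrN.
by congr (_ * M _ _ - M _ _ * M _ _); exact: val_inj.
Qed.

(** On rows B of U that form a basis, and the same rows B' of U', the matrix
    must be B^-1 B'; equality of the Gram matrices makes it orthogonal, and correct
    on all rows because the rows of U' are known by their products with those
    of B'. *)
Lemma gram_orthogonal n (U U' : 'M[R]_(n, 2)) (f : 'I_2 -> 'I_n) :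
  U *m U^T = U' *m U'^T -> \det (mxsub f f (U *m U^T)) != 0 ->
  exists Q : 'M[R]_2, Q *m Q^T = 1%:M /\ U' = U *m Q.
Proof.
move=> E D; set B := rowsub f U; set B' := rowsub f U'.
have BB : B *m B^T = mxsub f f (U *m U^T).
  by rewrite mxsub_mul; congr (_ *m _); rewrite trmx_mxsub.
have BB' : B' *m B'^T = B *m B^T.
  by rewrite BB E mxsub_mul; congr (_ *m _); rewrite trmx_mxsub.
have BU : B \in unitmx.
  by move: D; rewrite -BB det_mulmx mulf_eq0 negb_or unitmxE unitfE => /andP[].
have BU' : B'^T \in unitmx.
  by move: D; rewrite -BB -BB' det_mulmx mulf_eq0 negb_or unitmxE unitfE => /andP[].
exists (invmx B *m B'); split.
  by rewrite trmx_mul mulmxA -(mulmxA (invmx B)) BB' mulmxA mulVmx // mul1mx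
    trmx_inv mulmxV // unitmx_tr.
apply: (can_inj (mulmxK BU')).
rewrite !mulmxA -(mulmxA _ B' B'^T) BB' mulmxA mulmxKV //.
have UB : U *m B^T = colsub f (U *m U^T) by rewrite -mulmx_colsub trmx_mxsub.
have UB' : U' *m B'^T = colsub f (U' *m U'^T) by rewrite -mulmx_colsub trmx_mxsub.
by rewrite UB UB' E.
Qed.

Lemma gram_independent (c : 'I_5 -> 'I_5 -> R) : gram5 c -> exists i j, c i j ^+ 2 != 1.
Proof.
move=> cG; have [s sC] := exists_chamber cG.
(* In the chamber, c 0 4 is at most b and cannot be 1; it is at least -3 / 4
   because c 0 4 + c 1 4 = b - a - 1 / 2. *)
exists (s i0), (s i4); have wG := gram5_relabel s cG.
set w := relabel s c in sC wG *; change (w i0 i4 ^+ 2 != 1).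
have s_b := chamber_s_le wG sC; have [sE _] := gram_apex wG.
have b0 := chamber_b_ge0 sC; have ba := chamber_b_le_a sC; have a1 := chamber_a_le1 wG.
have /and5P[s0 _ _ _ _] := sC.
have lt1 : w i0 i4 < 1.
  have [b1|b1] := ltrP (w i2 i3) 1; first by lra.
  have eb : w i2 i3 = 1 by lra.
  by rewrite -eb; apply: chamber_s_lt => //; rewrite eb; lra.
rewrite lt_eqF //; have : 0 < (1 - w i0 i4) * (1 + w i0 i4) by apply: mulr_gt0; lra.
lra.
Qed.

Definition side_mx x : 'M[R]_(5, 2) := \matrix_(i, k) side_coord x k i.

Lemma side_mx_gram x i j : (side_mx x *m (side_mx x)^T) i j = cgram x i j.
Proof. by rewrite !mxE !big_ord_recl big_ord0 addr0 !mxE cgram_dot. Qed.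

(** The orthogonal matrix relating the edges, followed by the translation
    that matches the first vertices, matches all of them. *)
Lemma cgram_euclidean x y : conf_space (pentagon l_gt0) x -> cgram x = cgram y ->
  exists2 g, euclidean_group R g & forall v, y v = g (x v).
Proof.
move=> xC E; have cG := cgram_gram5 xC; have [i [j ij]] := gram_independent cG.
pose f (k : 'I_2) := if k == ord0 then i else j.
have [|| Q [QQ yQ]] := @gram_orthogonal 5 (side_mx x) (side_mx y) f.
- by apply/matrixP => a b; rewrite !side_mx_gram E.
- rewrite det2 ![mxsub _ _ _ _ _]mxE !side_mx_gram /f /=.
  by rewrite !gram_diag // (gram_sym cG j i) mul1r -expr2 subr_eq0 eq_sym.
have QT := mulmx1C QQ.
have step k : y (ordS k) - y k = (x (ordS k) - x k) *m Q.
  have dE z : z (ordS k) - z k = l *: row k (side_mx z) :> 'rV[R]_2.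
    by apply/rowP => b; rewrite !mxE /side_coord mulrC divfK.
  by rewrite !dE yQ row_mul -scalemxAl.
pose g p := (p - x i0) *m Q + y i0.
have gS k : y k = g (x k) -> y (ordS k) = g (x (ordS k)).
  move=> h; rewrite -[LHS](subrK (y k)) step h /g addrA; congr (_ + _).
  by rewrite -mulmxDl; congr (_ *m _); rewrite addrA subrK.
have S0 : ordS i0 = i1 by exact: val_inj.
have S1 : ordS i1 = i2 by exact: val_inj.
have S2 : ordS i2 = i3 by exact: val_inj.
have S3 : ordS i3 = i4 by exact: val_inj.
have g0 : y i0 = g (x i0) by rewrite /g subrr mul0mx add0r.
have g1 := gS _ g0; rewrite S0 in g1; have g2 := gS _ g1; rewrite S1 in g2.
have g3 := gS _ g2; rewrite S2 in g3; have g4 := gS _ g3; rewrite S3 in g4.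
exists g; last by elim/ord5_ind.
split.
  exists (fun p => (p - y i0) *m Q^T + x i0) => p; rewrite /g addrK -mulmxA.
    by rewrite QQ mulmx1 subrK.
  by rewrite QT mulmx1 subrK.
move=> p q; apply/eqP; rewrite /edist enorm_eq; apply/eqP.
have E2 (v : 'rV[R]_2) : enorm v ^+ 2 = (v *m v^T) ord0 ord0.
  by rewrite enorm_sqr !mxE !big_ord_recl big_ord0 addr0 !mxE.
rewrite !E2; congr (fun_of_matrix _ _ _).
have -> : g p - g q = (p - q) *m Q.
  by rewrite /g opprD addrACA subrr addr0 -mulmxBl opprB addrA subrK.
by rewrite trmx_mul mulmxA -(mulmxA (p - q)) QQ mulmx1.
Qed.

Lemma dih_pentagon_edge r b (i j : 'I_5) : pentagon_edge (dih r b i) (dih r b j) = pentagon_edge i j.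
Proof. by case: b; elim/ord5_ind: r; elim/ord5_ind: i; elim/ord5_ind: j. Qed.

Lemma dih_inj r b : injective (dih r b).
Proof.
by case: b; elim/ord5_ind: r; elim/ord5_ind; elim/ord5_ind => // /(congr1 val).
Qed.

Lemma dih_ordS r i : dih r false (ordS i) = ordS (dih r false i).
Proof. by apply: val_inj; elim/ord5_ind: r; elim/ord5_ind: i. Qed.

Lemma dih_ordSr r i : ordS (dih r true (ordS i)) = dih r true i.
Proof. by apply: val_inj; elim/ord5_ind: r; elim/ord5_ind: i. Qed.

Lemma dih_succ r i : dih (ordS r) true (ordS i) = dih r true i.
Proof. by apply: val_inj; elim/ord5_ind: r; elim/ord5_ind: i. Qed.

Lemma cgram_dih_rot x r i j :
  cgram (x \o dih r false) i j = cgram x (dih r false i) (dih r false j).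
Proof. by rewrite !cgram_dot /side_coord /= !dih_ordS. Qed.

(** A reflection of the vertices sends the edge from m to m + 1 to an edge run
    through backwards, whose first vertex is the image of m + 1. *)
Lemma cgram_dih_refl x r i j :
  cgram (x \o dih r true) i j = cgram x (dih r true (ordS i)) (dih r true (ordS j)).
Proof.
have S k m : side_coord (x \o dih r true) k m = - side_coord x k (dih r true (ordS m)).
  by rewrite /side_coord /= dih_ordSr -mulNr opprB.
by rewrite !cgram_dot !S !mulrNN.
Qed.

(** The images of consecutive vertices are consecutive, and injectivity
    forbids turning back. *)
Lemma pentagon_edge_dih (f : 'I_5 -> 'I_5) : injective f ->
  (forall i j, pentagon_edge i j -> pentagon_edge (f i) (f j)) -> exists r b, f =1 dih r b.
Proof.
move=> fI K.
have pN i j : i != j -> f i != f j by rewrite (inj_eq fI).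
suff [b bE] : exists b, [/\ f i1 = dih (f i0) b i1, f i2 = dih (f i0) b i2,
    f i3 = dih (f i0) b i3 & f i4 = dih (f i0) b i4].
  by exists (f i0), b; case: bE => *; elim/ord5_ind => //;
    move: (f i0); elim/ord5_ind; case: (b); exact: val_inj.
have := K i0 i1 isT; have := K i1 i2 isT; have := K i2 i3 isT; have := K i3 i4 isT.
have := K i4 i0 isT.
have := pN i0 i2 isT; have := pN i1 i3 isT; have := pN i2 i4 isT.
have := pN i0 i3 isT; have := pN i1 i4 isT.
move=> n14 n03 n24 n13 n02 k40 k34 k23 k12 k01.
move: (f i0) (f i1) k01 (f i2) k12 n02 (f i3) k23 n13 n03 (f i4) k34 k40 n24 n14.
clear; elim/ord5_ind; elim/ord5_ind => // _; elim/ord5_ind => // _ // _;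
  elim/ord5_ind => // _ // _ // _; elim/ord5_ind => // _ // _ // _ // _.
all: by ((exists false; split; exact: val_inj) || (exists true; split; exact: val_inj)).
Qed.

Lemma aut_edges (f : [subg linkage_aut (pentagon l_gt0)]) :
  exists d : {perm 'I_5}, (forall i j, pentagon_edge (d i) (d j) = pentagon_edge i j) /\
    forall x i j, cgram (x \o sgval f) i j = cgram x (d i) (d j).
Proof.
have /linkage_autP[fe _] := subgP f.
have [|r [b fE]] := @pentagon_edge_dih _ (@perm_inj _ (sgval f)).
  by move=> i j ij; have := fe i j; rewrite /= ij.
case: b fE => fE.
  have dI : injective (fun i => dih r true (ordS i)).
    by move=> i j /dih_inj/ordS_inj.
  exists (perm dI); split=> [i j|x i j]; rewrite !permE; last first.
    rewrite -cgram_dih_refl; congr (cgram _ i j).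
    by apply/funext => k /=; rewrite fE.
  by rewrite dih_pentagon_edge; elim/ord5_ind: i; elim/ord5_ind: j.
exists (perm (@dih_inj r false)); split=> [i j|x i j]; rewrite !permE; last first.
  rewrite -cgram_dih_rot; congr (cgram _ i j).
  by apply/funext => k /=; rewrite fE.
exact: dih_pentagon_edge.
Qed.

Lemma dih_aut r b : exists f : [subg linkage_aut (pentagon l_gt0)],
  forall x i j, cgram (x \o sgval f) i j = cgram x (dih r b i) (dih r b j).
Proof.
have autP s b' (p := perm (@dih_inj s b')) : p \in linkage_aut (pentagon l_gt0).
  apply/linkage_autP; split=> // u v.
  by rewrite !permE /= dih_pentagon_edge.
pose s := if b then ordS r else r.
exists (subg _ (perm (@dih_inj s b))) => x i j; rewrite subgK; last exact: autP.
have -> : x \o perm (@dih_inj s b) = x \o dih s b by apply/funext => k /=; rewrite permE.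
rewrite /s; case: b {s} => /=; last exact: cgram_dih_rot.
by rewrite cgram_dih_refl !dih_succ.
Qed.

End Geometry.

(** * General topology *)

Section Topology.
Local Open Scope classical_set_scope.

Lemma closed_cover_continuous (S T : topologicalType) (I : finType)
    (A : I -> set S) (g : I -> S -> T) (f : S -> T) :
  (forall i, closed (A i)) -> (forall x, exists i, A i x) ->
  (forall i x, A i x -> f x = g i x) ->
  (forall i x, A i x -> {for x, continuous (g i)}) -> continuous f.
Proof.
move=> cA covA fg cg x V fV.
have H i : \forall y \near x, A i y -> V (g i y).
  have [Ax|nAx] := pselect (A i x).
    have gV : nbhs (g i x) V by rewrite -(fg i x Ax).
    have xV : nbhs x (g i @^-1` V) := cg i x Ax V gV.
    by apply: filterS xV => y /= Vy _.
  have : nbhs x (~` A i) by apply: open_nbhs_nbhs; split => //; exact: closed_openC.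
  by apply: filterS => y /= nAy /nAy.
have := filter_forall (nbhs_filter x) H; apply: filterS => y Hy /=.
by have [i Ay] := covA y; rewrite /= (fg i y Ay); exact: Hy.
Qed.

Lemma hausdorff_injective (S T : topologicalType) (f : S -> T) :
  continuous f -> injective f -> hausdorff_space T -> hausdorff_space S.
Proof.
move=> cf fI hT p q cl; apply: fI; apply: hT => A B /cf nA /cf nB.
by have [x [Ax Bx]] := cl _ _ nA nB; exists (f x).
Qed.

Lemma compact_bijection_homeomorphic (S T : topologicalType) (f : S -> T) :
  compact [set: S] -> hausdorff_space T -> continuous f -> injective f ->
  (forall y, exists x, f x = y) -> homeomorphic S T.
Proof.
move=> cS hT cf fI fS; pose g y := sval (cid (fS y)).
have gK : cancel g f by move=> y; rewrite /g; case: cid.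
have fK : cancel f g by move=> x; apply: fI; rewrite gK.
exists f, g; split => //; apply/continuous_closedP => C cC.
have -> : g @^-1` C = f @` C.
  apply/seteqP; split => [y /= Cy|_ [x Cx <-]] /=; last by rewrite fK.
  by exists (g y).
apply: compact_closed => //; apply: continuous_compact.
  exact: continuous_subspaceT.
exact: subclosed_compact cC cS _.
Qed.

Variable R : realType.

Section Real.
Variable T : topologicalType.
Implicit Types f g : T -> R.

Lemma continuous_atD f g x : {for x, continuous f} -> {for x, continuous g} ->
  {for x, continuous (fun y => f y + g y)}.
Proof. by move=> cf cg; exact: cvgD cf cg. Qed.
Lemma continuous_atB f g x : {for x, continuous f} -> {for x, continuous g} ->
  {for x, continuous (fun y => f y - g y)}.
Proof. by move=> cf cg; exact: cvgB cf cg. Qed.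
Lemma continuous_atM f g x : {for x, continuous f} -> {for x, continuous g} ->
  {for x, continuous (fun y => f y * g y)}.
Proof. by move=> cf cg; exact: cvgM cf cg. Qed.
Lemma continuous_at_cst (k : R) x : {for x, continuous (fun _ : T => k)}.
Proof. exact: cvg_cst. Qed.
Lemma continuous_atV f x : f x != 0 -> {for x, continuous f} ->
  {for x, continuous (fun y => (f y)^-1)}.
Proof. by move=> f0 cf; exact: cvgV f0 cf. Qed.
Lemma continuous_atX f n x : {for x, continuous f} -> {for x, continuous (fun y => f y ^+ n)}.
Proof.
move=> cf; elim: n => [|n IH]; first exact: continuous_at_cst.
rewrite (_ : (fun y => _) = (fun y => f y * f y ^+ n)); last by apply/funext => y; rewrite exprS.
exact: continuous_atM.
Qed.

(** A factor that is bounded but not continuous does no harm at a zero of the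
    other one. *)
Lemma continuous_at_bounded0 f g x : {for x, continuous f} -> f x = 0 -> (forall y, `|g y| <= 1) ->
  {for x, continuous (fun y => f y * g y)}.
Proof.
move=> cf f0 g1; rewrite /prop_for /continuous_at f0 mul0r.
apply/cvgr0Pnorm_lt => e e0.
have : f @ x --> (0 : R) by rewrite -f0; exact: cf.
move/cvgr0Pnorm_lt => /(_ e e0); apply: filterS => y; apply: le_lt_trans.
by rewrite normrM ler_piMr.
Qed.

Lemma closed_le_fun f g : continuous f -> continuous g -> closed [set x | f x <= g x].
Proof.
move=> cf cg.
have -> : [set x | f x <= g x] = (fun x => g x - f x) @^-1` [set r | 0 <= r].
  by apply/seteqP; split => x /=; rewrite subr_ge0.
have /continuous_closedP : continuous (fun x => g x - f x).
  by move=> x; apply: continuous_atB; [exact: cg|exact: cf].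
by apply; exact: closed_ge.
Qed.

Lemma closed_eq_fun f k : continuous f -> closed [set x | f x = k].
Proof.
by move=> /continuous_closedP cf; apply: (cf [set k]); exact: closed_eq.
Qed.

End Real.
End Topology.

(** * From the square to the disc *)

Section Round.
Variable R : realType.
Local Open Scope classical_set_scope.
Local Open Scope quotient_scope.
Let j0 : 'I_2 := ord0.
Let j1 : 'I_2 := lift ord0 ord0.
Implicit Types z : R * R.

Definition supn z : R := Num.max `|z.1| `|z.2|.
Definition eucn z : R := Num.sqrt (z.1 ^+ 2 + z.2 ^+ 2).
(** Radial dilation, turning the sup norm into the Euclidean one. At z = 0 the
    ratio of the norms is 0 / 0 = 0, which gives the right value. *)
Definition square_to_disc z : 'rV[R]_2 :=
  \row_k ((if k == ord0 then z.1 else z.2) * (supn z / eucn z)).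

Lemma square_to_disc0 z : square_to_disc z ord0 j0 = z.1 * (supn z / eucn z).
Proof. by rewrite mxE. Qed.
Lemma square_to_disc1 z : square_to_disc z ord0 j1 = z.2 * (supn z / eucn z).
Proof. by rewrite mxE. Qed.

Lemma supn_ge0 z : 0 <= supn z.
Proof. by rewrite /supn le_max normr_ge0. Qed.
Lemma eucn_ge0 z : 0 <= eucn z.
Proof. exact: sqrtr_ge0. Qed.

Lemma eucn_sqr z : eucn z ^+ 2 = z.1 ^+ 2 + z.2 ^+ 2.
Proof. by rewrite sqr_sqrtr // addr_ge0 ?sqr_ge0. Qed.

Lemma supn_le_eucn z : supn z <= eucn z.
Proof.
have N (t u : R) : `|t| <= Num.sqrt (t ^+ 2 + u ^+ 2).
  by rewrite -sqrtr_sqr ler_wsqrtr // lerDl sqr_ge0.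
by rewrite /supn ge_max /eucn N addrC N.
Qed.

Lemma eucn_eq0 z : (eucn z == 0) = (z == 0).
Proof.
rewrite -(@eqrXn2 _ 2 _ 0) ?eucn_ge0 // eucn_sqr expr0n /= paddr_eq0 ?sqr_ge0 // !sqrf_eq0.
by case: z => a b.
Qed.

Lemma supn_eq0 z : (supn z == 0) = (z == 0).
Proof.
apply/eqP/eqP => [h|->]; last by rewrite /supn /= normr0 maxxx.
have := supn_ge0 z; have: `|z.1| <= supn z by rewrite /supn le_max lexx.
have: `|z.2| <= supn z by rewrite /supn le_max lexx orbT.
by rewrite h !normr_le0 => /eqP b /eqP a _; case: z a b {h} => a b /= -> ->.
Qed.

Lemma supnZ (k : R) z : 0 <= k -> supn (k * z.1, k * z.2) = k * supn z.
Proof. by move=> k0; rewrite /supn /= !normrM ger0_norm // maxr_pMr. Qed.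

Lemma eucnZ (k : R) z : 0 <= k -> eucn (k * z.1, k * z.2) = k * eucn z.
Proof.
move=> k0; rewrite /eucn /= !exprMn -mulrDr sqrtrM ?sqr_ge0 //.
by rewrite sqrtr_sqr ger0_norm.
Qed.

Lemma ratio_le1 z : `|supn z / eucn z| <= 1.
Proof.
have [e0|e0] := eqVneq (eucn z) 0; first by rewrite e0 invr0 mulr0 normr0.
have e1 : 0 < eucn z by rewrite lt_neqAle eq_sym e0 eucn_ge0.
by rewrite ger0_norm ?divr_ge0 ?supn_ge0 ?eucn_ge0 // ler_pdivrMr // mul1r supn_le_eucn.
Qed.

Lemma enorm_square_to_disc z : enorm (square_to_disc z) = supn z.
Proof.
apply/eqP; rewrite -(@eqrXn2 _ 2) ?enorm_ge0 ?supn_ge0 // enorm_sqr square_to_disc0 square_to_disc1.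
rewrite !exprMn -mulrDl -eucn_sqr.
have [z0|z0] := eqVneq z 0.
  have /eqP -> : supn z == 0 by rewrite supn_eq0 z0.
  by rewrite !expr0n /= mul0r mulr0.
by rewrite exprVn mulrCA divff ?mulr1 // sqrf_eq0 eucn_eq0.
Qed.

Lemma square_to_disc_inj : injective square_to_disc.
Proof.
move=> z z' E; have N : supn z = supn z' by rewrite -!enorm_square_to_disc E.
have [z0|z0] := eqVneq z 0.
  by apply/eqP; rewrite z0 eq_sym -supn_eq0 -N supn_eq0 z0.
have z'0 : z' != 0 by rewrite -supn_eq0 -N supn_eq0.
have sz : 0 < supn z by rewrite lt_neqAle eq_sym supn_eq0 z0 supn_ge0.
have ez : 0 < eucn z by rewrite lt_neqAle eq_sym eucn_eq0 z0 eucn_ge0.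
have ez' : 0 < eucn z' by rewrite lt_neqAle eq_sym eucn_eq0 z'0 eucn_ge0.
pose k := eucn z' / eucn z; have k0 : 0 < k by rewrite divr_gt0.
have K (t t' : R) : t * (supn z / eucn z) = t' * (supn z' / eucn z') -> t' = k * t.
  rewrite -N => h.
  have {}h : t / eucn z = t' / eucn z' by apply: (mulfI (lt0r_neq0 sz)); rewrite mulrCA h mulrCA.
  by rewrite /k mulrAC -mulrA h mulrC divfK // gt_eqF.
have zE : z' = (k * z.1, k * z.2).
  rewrite (surjective_pairing z'); congr pair; apply: K.
    by rewrite -!square_to_disc0 E.
  by rewrite -!square_to_disc1 E.
have := N; rewrite zE supnZ ?(ltW k0) // -{1}[supn z]mul1r.
move/(mulIf (lt0r_neq0 sz)) => k1.
by rewrite -k1 !mul1r -surjective_pairing.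
Qed.

Lemma square_to_disc_surj (w : 'rV[R]_2) : enorm w <= 1 ->
  exists z, square_to_disc z = w /\ supn z <= 1.
Proof.
move=> w1; pose y := (w ord0 j0, w ord0 j1).
have ey : enorm w = eucn y.
  by apply/eqP; rewrite -(@eqrXn2 _ 2) ?enorm_ge0 ?eucn_ge0 // enorm_sqr eucn_sqr.
have [y0|y0] := eqVneq y 0.
  exists 0; split; last by rewrite (eqP (_ : supn 0 == 0)) ?supn_eq0.
  have [wa wb] : w ord0 j0 = 0 /\ w ord0 j1 = 0 by move: y0; rewrite /y => -[-> ->].
  by apply: rv2E; rewrite ?square_to_disc0 ?square_to_disc1 ?wa ?wb mul0r.
have sy : 0 < supn y by rewrite lt_neqAle eq_sym supn_eq0 y0 supn_ge0.
have eyy : 0 < eucn y by rewrite lt_neqAle eq_sym eucn_eq0 y0 eucn_ge0.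
pose k := eucn y / supn y; have k0 : 0 < k by rewrite divr_gt0.
have kk : supn (k * y.1, k * y.2) / eucn (k * y.1, k * y.2) = k^-1.
  by rewrite supnZ ?eucnZ ?(ltW k0) // -mulf_div divff ?gt_eqF // mul1r invf_div.
have sk : supn (k * y.1, k * y.2) = eucn y.
  by rewrite supnZ ?(ltW k0) // /k divfK // gt_eqF.
exists (k * y.1, k * y.2); split; last by rewrite sk -ey.
have k00 : k != 0 by rewrite gt_eqF.
by apply: rv2E; rewrite ?square_to_disc0 ?square_to_disc1 kk [LHS]mulrC mulKf.
Qed.

Lemma supn_le1 z : supn z <= 1 <-> -1 <= z.1 <= 1 /\ -1 <= z.2 <= 1.
Proof. by rewrite /supn ge_max !ler_norml; split=> [/andP|[-> ->]]. Qed.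

Lemma square_to_disc_continuous (T : topologicalType) (f : T -> R * R) :
  continuous (fun x => (f x).1) -> continuous (fun x => (f x).2) ->
  continuous (fun x => square_to_disc (f x)).
Proof.
move=> c1 c2.
have cf (h : T -> R) : continuous h -> (forall x, eucn (f x) = 0 -> h x = 0) ->
    continuous (fun x => h x * (supn (f x) / eucn (f x))).
  move=> ch h0 x; have [e0|e0] := eqVneq (eucn (f x)) 0.
    apply: (@continuous_at_bounded0 _ _ h (fun y => supn (f y) / eucn (f y)) x); first exact: ch.
      exact: h0.
    by move=> y; exact: ratio_le1.
  have cs : {for x, continuous (fun y => supn (f y))}.
    apply: (@continuous_max _ _ (fun y => `|(f y).1| : R^o) (fun y => `|(f y).2| : R^o)).
      exact: (continuous_comp (c1 x) (@norm_continuous _ R^o _)).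
    exact: (continuous_comp (c2 x) (@norm_continuous _ R^o _)).
  have ce : {for x, continuous (fun y => eucn (f y))}.
    apply: (@continuous_comp _ _ _ (fun y => (f y).1 ^+ 2 + (f y).2 ^+ 2) Num.sqrt x).
      by apply: (@continuous_atD _ _ (fun y => (f y).1 ^+ 2) (fun y => (f y).2 ^+ 2));
         apply: continuous_atX; [exact: c1|exact: c2].
    exact: sqrt_continuous.
  have cr : {for x, continuous (fun y => supn (f y) / eucn (f y))}.
    apply: (@continuous_atM _ _ (fun y => supn (f y)) (fun y => (eucn (f y))^-1) x cs).
    exact: (@continuous_atV _ _ (fun y => eucn (f y)) x e0 ce).
  exact: (@continuous_atM _ _ h (fun y => supn (f y) / eucn (f y)) x (ch x) cr).
have E z : eucn z = 0 -> z = 0 by move/eqP; rewrite eucn_eq0 => /eqP.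
have cx := cf _ c1 (fun x h => congr1 fst (E _ h)).
have cy := cf _ c2 (fun x h => congr1 snd (E _ h)).
have -> : (fun x => square_to_disc (f x)) = (fun x =>
    ((f x).1 * (supn (f x) / eucn (f x))) *: delta_mx ord0 j0 +
    ((f x).2 * (supn (f x) / eucn (f x))) *: delta_mx ord0 j1).
  by apply/funext => x; apply: rv2E;
    rewrite ?square_to_disc0 ?square_to_disc1 !mxE /= ?mulr1 ?mulr0 ?addr0 ?add0r.
move=> x; apply: cvgD; apply: cvgZr_tmp; [exact: cx | exact: cy].
Qed.

End Round.

(** * The map from configurations to the disc *)

Section Final.
Variable R : realType.
Local Open Scope classical_set_scope.
Local Open Scope quotient_scope.
Variables (l : R) (l_gt0 : 0 < l).
Let l_neq0 : l != 0. Proof. by rewrite gt_eqF. Qed.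
Let j0 : 'I_2 := ord0.
Let j1 : 'I_2 := lift ord0 ord0.
Local Notation conf := (conf_space (pentagon l_gt0)).

Lemma gram5_conf (c : 'I_5 -> 'I_5 -> R) : gram5 c ->
  exists x : 'I_5 -> 'rV[R]_2, conf x /\ cgram l x = c.
Proof.
move=> [X [Y [cE c1 X0 Y0]]].
pose pos (F : 'I_5 -> R) (k : 'I_5) : R :=
  nth 0 [:: 0; F i0; F i0 + F i1; F i0 + F i1 + F i2; F i0 + F i1 + F i2 + F i3] k.
have posS F i : \sum_j F j = 0 -> pos F (ordS i) - pos F i = F i.
  by rewrite sum5 => F0; elim/ord5_ind: i; rewrite /pos /=; lra.
pose x (k : 'I_5) : 'rV[R]_2 := \row_b (l * (if b == ord0 then pos X k else pos Y k)).
have s0 i : side_coord l x j0 i = X i by rewrite /side_coord !mxE /= -mulrBr posS // [l * _]mulrC mulfK.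
have s1 i : side_coord l x j1 i = Y i by rewrite /side_coord !mxE /= -mulrBr posS // [l * _]mulrC mulfK.
have gE : cgram l x = c.
  by do 2!apply/funext => ?; rewrite cgram_dot s0 s1 s0 s1 cE.
exists x; split => //; apply/conf_edge => i; apply/eqP.
rewrite -(@eqrXn2 _ 2) ?enorm_ge0 ?(ltW l_gt0) // /edist enorm_sqr !mxE /=.
have := c1 i; rewrite cE -[X i](posS X i X0) -[Y i](posS Y i Y0) => h.
by apply/eqP; rewrite -[RHS]mulr1 -h; lra.
Qed.

Lemma coord_conf_continuous (i : 'I_5) (k : 'I_2) :
  continuous (fun x : {ptws 'I_5 -> 'rV[R]_2} => x i ord0 k).
Proof.
move=> x; apply: (@continuous_comp _ _ _ (fun x : {ptws 'I_5 -> 'rV[R]_2} => x i)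
  (fun v : 'rV[R]_2 => v ord0 k)).
  exact: proj_continuous.
exact: coord_continuous.
Qed.

Lemma cgram_continuous i j :
  continuous (fun x : {ptws 'I_5 -> 'rV[R]_2} => cgram l x i j).
Proof.
have S k m : continuous (fun x : {ptws 'I_5 -> 'rV[R]_2} => side_coord l x k m).
  move=> x.
  apply: (@continuous_atM _ _ (fun x : {ptws 'I_5 -> 'rV[R]_2} => x (ordS m) ord0 k - x m ord0 k)
    (fun _ => l^-1)); last exact: continuous_at_cst.
  by apply: (@continuous_atB _ _ (fun x : {ptws 'I_5 -> 'rV[R]_2} => x (ordS m) ord0 k)
    (fun x => x m ord0 k)); exact: coord_conf_continuous.
rewrite (_ : (fun x => _) = (fun x : {ptws 'I_5 -> 'rV[R]_2} =>
   side_coord l x j0 i * side_coord l x j0 j + side_coord l x j1 i * side_coord l x j1 j)).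
  have D k : continuous (fun x : {ptws 'I_5 -> 'rV[R]_2} => side_coord l x k i * side_coord l x k j).
    by move=> x; exact: (@continuous_atM _ _ (fun x : {ptws 'I_5 -> 'rV[R]_2} => side_coord l x k i)
      (fun x => side_coord l x k j) x (S k i x) (S k j x)).
  by move=> x; exact: (@continuous_atD _ _ _ _ x (D j0 x) (D j1 x)).
by apply/funext => x; rewrite cgram_dot.
Qed.

Lemma conf_closed : closed (conf : set {ptws 'I_5 -> 'rV[R]_2}).
Proof.
rewrite (_ : (conf : set _) = \bigcap_(i in [set: 'I_5]) [set x : {ptws 'I_5 -> 'rV[R]_2} |
   (x i ord0 j0 - x (ordS i) ord0 j0) ^+ 2 + (x i ord0 j1 - x (ordS i) ord0 j1) ^+ 2 = l ^+ 2]).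
  apply: closed_bigI => i _; apply: closed_eq_fun => x.
  have D k : {for x, continuous (fun x : {ptws 'I_5 -> 'rV[R]_2} =>
      (x i ord0 k - x (ordS i) ord0 k) ^+ 2)}.
    apply: (@continuous_atX _ _ (fun x : {ptws 'I_5 -> 'rV[R]_2} => x i ord0 k - x (ordS i) ord0 k)).
    by apply: (@continuous_atB _ _ (fun x : {ptws 'I_5 -> 'rV[R]_2} => x i ord0 k)
      (fun x => x (ordS i) ord0 k)); exact: coord_conf_continuous.
  exact: (@continuous_atD _ _ _ _ x (D j0) (D j1)).
have E (x : {ptws 'I_5 -> 'rV[R]_2}) i : edist (x i) (x (ordS i)) = l <->
   (x i ord0 j0 - x (ordS i) ord0 j0) ^+ 2 + (x i ord0 j1 - x (ordS i) ord0 j1) ^+ 2 = l ^+ 2.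
  rewrite (_ : _ + _ = edist (x i) (x (ordS i)) ^+ 2); last by rewrite /edist enorm_sqr !mxE.
  split=> [-> //|/eqP]; rewrite eqrXn2 ?enorm_ge0 ?(ltW l_gt0) // => /eqP //.
apply/seteqP; split => [x /conf_edge H i _|x H]; first exact/E.
by apply/conf_edge => i; apply/E; exact: H.
Qed.

Local Notation X := (set_type conf).
Definition gram_of (x : X) : 'I_5 -> 'I_5 -> R := cgram l (set_val x).

Lemma gram_of_gram5 x : gram5 (gram_of x).
Proof. by apply: cgram_gram5; exact: set_valP. Qed.

Lemma gram_of_continuous i j : continuous (fun x : X => gram_of x i j).
Proof.
move=> x; apply: (@continuous_comp X _ _ set_val (fun y => cgram l y i j)).
  exact: initial_continuous.
exact: cgram_continuous.
Qed.

Section Weights.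
Variables (T : topologicalType) (c : T -> 'I_5 -> 'I_5 -> R) (x : T).
Hypothesis cc : forall i j, {for x, continuous (fun y => c y i j)}.

Lemma slack_continuous : {for x, continuous (fun y => slack (c y))}.
Proof.
have k (r : R) := @continuous_at_cst _ T r x.
have b2 := @continuous_atM _ _ _ _ x (k 4) (@continuous_atX _ _ _ 2 x (@cc i2 i3)).
have b1 := @continuous_atM _ _ _ _ x (k 4) (@cc i2 i3).
have a1 := @continuous_atM _ _ _ _ x (k 2) (@cc i0 i1).
exact: (@continuous_atB _ _ _ _ x (@continuous_atB _ _ _ _ x
  (@continuous_atD _ _ _ _ x b2 b1) (k 1)) a1).
Qed.

Lemma weights_continuous : weight_sum (c x) != 0 ->
  [/\ {for x, continuous (fun y => weight_P (c y))},
      {for x, continuous (fun y => weight_Q (c y))} &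
      {for x, continuous (fun y => weight_M (c y))}].
Proof.
move=> t0; have cg := slack_continuous.
have k (r : R) := @continuous_at_cst _ T r x.
have ct : {for x, continuous (fun y => weight_sum (c y))}.
  exact: (@continuous_atD _ _ _ _ x (@continuous_atB _ _ _ _ x (k 1) (@cc i2 i3)) cg).
have cv : {for x, continuous (fun y => (weight_sum (c y))^-1)}.
  exact: (@continuous_atV _ _ (fun y => weight_sum (c y)) x t0 ct).
split.
- exact: (@continuous_atM _ _ _ _ x (@continuous_atB _ _ _ _ x (k 1) (@cc i0 i1)) cv).
- exact: (@continuous_atM _ _ _ _ x cg cv).
- exact: (@continuous_atM _ _ _ _ x (@continuous_atB _ _ _ _ x (@cc i0 i1) (@cc i2 i3)) cv).
Qed.

End Weights.

Lemma chamber_image_continuous (s : {perm 'I_5}) (x : X) : chamber (relabel s (gram_of x)) ->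
  {for x, continuous (fun x => (chamber_image s (gram_of x)).1)} /\
  {for x, continuous (fun x => (chamber_image s (gram_of x)).2)}.
Proof.
move=> sC; have T := weight_sum_gt0 (gram5_relabel s (gram_of_gram5 x)) sC.
have c i j : {for x, continuous (fun x => relabel s (gram_of x) i j)}.
  exact: gram_of_continuous.
have [cP cQ cM] := weights_continuous c (lt0r_neq0 T).
have k (r : R) := @continuous_at_cst _ X r x.
by split; exact: (@continuous_atD _ _ _ _ x
  (@continuous_atD _ _ _ _ x (@continuous_atM _ _ _ _ x cP (k _))
  (@continuous_atM _ _ _ _ x cQ (k _))) (@continuous_atM _ _ _ _ x cM (k _))).
Qed.

Lemma chamber_closed (s : {perm 'I_5}) :
  closed [set x : X | chamber (relabel s (gram_of x))].
Proof.
have c i j : continuous (fun x : X => relabel s (gram_of x) i j).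
  exact: gram_of_continuous.
have c0 : continuous (fun _ : X => 0 : R) by move=> ?; exact: continuous_at_cst.
have cg : continuous (fun x : X => slack (relabel s (gram_of x))).
  by move=> x; apply: slack_continuous => i j; exact: c.
rewrite (_ : mkset _ =
  [set x | relabel s (gram_of x) i1 i4 <= relabel s (gram_of x) i0 i4] `&`
  ([set x | relabel s (gram_of x) i2 i4 <= relabel s (gram_of x) i3 i4] `&`
  ([set x | relabel s (gram_of x) i2 i3 <= relabel s (gram_of x) i0 i1] `&`
  ([set x | 0 <= relabel s (gram_of x) i2 i3] `&`
   [set x | 0 <= slack (relabel s (gram_of x))])))).
  apply: closedI; first exact: (closed_le_fun (c _ _) (c _ _)).
  apply: closedI; first exact: (closed_le_fun (c _ _) (c _ _)).
  apply: closedI; first exact: (closed_le_fun (c _ _) (c _ _)).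
  apply: closedI; first exact: (closed_le_fun c0 (c _ _)).
  exact: (closed_le_fun c0 cg).
by apply/seteqP; split => x /=; rewrite /chamber;
  [move/and5P => [*] | move=> [? [? [? [? ?]]]]; exact/and5P].
Qed.

(** The conditions that the relabelling by s lies in the chamber define a
    finite closed cover. *)
Lemma square_image_continuous :
  continuous (fun x : X => (square_image (gram_of x)).1) /\
  continuous (fun x : X => (square_image (gram_of x)).2).
Proof.
split.
  apply: (@closed_cover_continuous _ _ {perm 'I_5} (fun s => [set x | chamber (relabel s (gram_of x))])
    (fun s x => (chamber_image s (gram_of x)).1)).
  - exact: chamber_closed.
  - by move=> x; exact: exists_chamber (gram_of_gram5 x).
  - by move=> s x sC; rewrite (square_imageE (gram_of_gram5 x) sC).
  - by move=> s x /chamber_image_continuous[].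
apply: (@closed_cover_continuous _ _ {perm 'I_5} (fun s => [set x | chamber (relabel s (gram_of x))])
    (fun s x => (chamber_image s (gram_of x)).2)).
- exact: chamber_closed.
- by move=> x; exact: exists_chamber (gram_of_gram5 x).
- by move=> s x sC; rewrite (square_imageE (gram_of_gram5 x) sC).
- by move=> s x /chamber_image_continuous[].
Qed.

Lemma image_in_disc (x : X) : closed_disc R (square_to_disc (square_image (gram_of x))).
Proof.
by rewrite /closed_disc /= enorm_square_to_disc; apply/supn_le1; exact: square_image_bound (gram_of_gram5 x).
Qed.

Definition to_disc (x : X) : set_type (closed_disc R) :=
  exist _ (square_to_disc (square_image (gram_of x))) (mem_set (image_in_disc x)).

Lemma to_disc_continuous : continuous to_disc.
Proof.
apply: continuous_comp_initial.
have [c1 c2] := square_image_continuous.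
exact: square_to_disc_continuous.
Qed.

Lemma to_disc_surj y : exists x, to_disc x = y.
Proof.
have [z [zE /supn_le1[z1 z2]]] := square_to_disc_surj (set_valP y).
have [c [cG cE]] := square_image_surj z1 z2.
have [x [xC xE]] := gram5_conf cG.
exists (exist _ x (mem_set xC)); apply: val_inj => /=.
by rewrite /gram_of /= xE cE -surjective_pairing zE.
Qed.

Lemma to_disc_euc (x y : X) : euc_equiv x y -> to_disc x = to_disc y.
Proof.
move=> /asboolP[g [_ gd] gE].
have E : gram_of x = gram_of y.
  have D i j : edist (set_val y i) (set_val y j) = edist (set_val x i) (set_val x j).
    by rewrite !gE gd.
  exact: esym (cgram_isom l D).
by apply: val_inj; rewrite /= E.
Qed.

Lemma to_disc_act f (x : X) : to_disc (conf_act f x) = to_disc x.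
Proof.
have [d [dC dE]] := aut_edges f.
have E : gram_of (conf_act f x) = relabel d (gram_of x).
  by do 2!apply/funext => ?; rewrite /gram_of dE.
by apply: val_inj; rewrite /= E (square_image_relabel (gram_of_gram5 x) dC).
Qed.

Lemma to_disc_inj (x y : X) : to_disc x = to_disc y ->
  exists f, euc_equiv x (conf_act f y).
Proof.
move=> /(congr1 val) /= /square_to_disc_inj E.
have [r [b rE]] := square_image_inj (gram_of_gram5 x) (gram_of_gram5 y) E.
have [f fE] := dih_aut l_gt0 r b; exists f; apply/asboolP.
apply: (@cgram_euclidean R l l_gt0 (set_val x) (set_val (conf_act f y))); first exact: set_valP.
by apply/funext => i; apply/funext => j; rewrite /= fE; exact: esym (rE i j).
Qed.

Local Notation SC := (sym_reduced_conf_space (pentagon l_gt0)).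
Local Notation RC := (reduced_conf_space (pentagon l_gt0)).

Definition reduced_to_disc (p : RC) := to_disc (repr p).
Definition sym_to_disc (p : SC) := reduced_to_disc (repr p).

Lemma reduced_to_disc_pi x : reduced_to_disc (\pi_RC x) = to_disc x.
Proof.
rewrite /reduced_to_disc; apply: to_disc_euc.
by apply/reduced_piP; rewrite reprK.
Qed.

Lemma aut_piP (p q : RC) : reflect (\pi_SC p = \pi_SC q) (aut_equiv p q).
Proof. exact: (@eqquotP _ (aut_rel (pentagon l_gt0)) {eq_quot (aut_rel (pentagon l_gt0))}). Qed.

Lemma reduced_to_disc_aut (p q : RC) : aut_equiv p q -> reduced_to_disc p = reduced_to_disc q.
Proof.
move=> /asboolP[f ->]; rewrite -[p]reprK reduced_act_pi !reduced_to_disc_pi.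
by rewrite to_disc_act.
Qed.

Lemma sym_to_disc_pi p : sym_to_disc (\pi_SC p) = reduced_to_disc p.
Proof.
rewrite /sym_to_disc; apply: reduced_to_disc_aut.
by apply/aut_piP; rewrite reprK.
Qed.

Lemma reduced_to_disc_continuous : continuous reduced_to_disc.
Proof.
apply: repr_comp_continuous; first exact: to_disc_continuous.
by move=> a b /eqP/reduced_piP/to_disc_euc ->.
Qed.

Lemma sym_to_disc_continuous : continuous sym_to_disc.
Proof.
apply: repr_comp_continuous; first exact: reduced_to_disc_continuous.
by move=> a b /eqP/aut_piP/reduced_to_disc_aut ->.
Qed.

Lemma sym_to_disc_inj : injective sym_to_disc.
Proof.
move=> p q; rewrite -[p]reprK -[q]reprK !sym_to_disc_pi.
move: (repr p) (repr q) => {}p {}q; rewrite -[p]reprK -[q]reprK !reduced_to_disc_pi.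
move: (repr p) (repr q) => x y /to_disc_inj[f /reduced_piP E].
apply/aut_piP; rewrite E; apply: aut_equiv_imp; apply/asboolP; exists f.
by rewrite reduced_act_pi.
Qed.

Lemma sym_to_disc_surj y : exists p, sym_to_disc p = y.
Proof.
have [x xE] := to_disc_surj y; exists (\pi_SC (\pi_RC x)).
by rewrite sym_to_disc_pi reduced_to_disc_pi.
Qed.

End Final.

(** * Compactness and conclusion *)

Section Compact.
Variable R : realType.
Local Open Scope classical_set_scope.
Local Open Scope quotient_scope.
Variables (l : R) (l_gt0 : 0 < l).
Local Notation conf := (conf_space (pentagon l_gt0)).
Local Notation X := (set_type conf).
Local Notation SC := (sym_reduced_conf_space (pentagon l_gt0)).
Local Notation RC := (reduced_conf_space (pentagon l_gt0)).

Definition class_of (x : X) : SC := \pi_SC (\pi_RC x).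

Lemma class_of_continuous : continuous class_of.
Proof.
move=> x; apply: (@continuous_comp X RC SC (\pi_RC) (\pi_SC)); exact: pi_continuous.
Qed.

Definition box : set {ptws 'I_5 -> 'rV[R]_2} :=
  [set x | forall i, [set v : 'rV[R]_2 | forall k, `[- (4 * l), 4 * l]%classic (v ord0 k)] (x i)].

Lemma box_compact : compact box.
Proof.
apply: (@tychonoff _ (fun _ : 'I_5 => 'rV[R]_2)
  (fun _ => [set v : 'rV[R]_2 | forall k, `[- (4 * l), 4 * l]%classic (v ord0 k)])) => _.
by apply: (@rV_compact R 2 (fun _ => `[- (4 * l), 4 * l]%classic)) => _; exact: segment_compact.
Qed.

Lemma coord_le_edist (p q : 'rV[R]_2) k : `|p ord0 k - q ord0 k| <= edist p q.
Proof.
rewrite -sqrtr_sqr /edist /enorm ler_wsqrtr //.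
rewrite (bigD1 k) //= !mxE lerDl; apply: sumr_ge0 => i _; exact: sqr_ge0.
Qed.

(** Put the vertex 0 at the origin; every edge increases the coordinates by
    at most l. *)
Lemma conf_translate (x : X) : exists y : X, box (set_val y) /\ class_of y = class_of x.
Proof.
pose g (p : 'rV[R]_2) := p - set_val x i0.
have gE p q : edist (g p) (g q) = edist p q by rewrite /edist /g opprB addrA subrK.
have yC : conf (g \o set_val x).
  by move=> u v uv /=; rewrite gE; exact: (set_valP x u v uv).
exists (exist _ (g \o set_val x) (mem_set yC)); split; last first.
  rewrite /class_of; congr (\pi_SC _); apply: esym; apply/reduced_piP/asboolP.
  exists g => //; split=> //; exists (fun p => p + set_val x i0) => p; rewrite /g.
    by rewrite subrK.
  by rewrite addrK.
have step k i : `|set_val x (ordS i) ord0 k - set_val x i ord0 k| <= l.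
  have /conf_edge xE := set_valP x; rewrite distrC.
  by apply: (le_trans (coord_le_edist _ _ _)); rewrite xE.
move=> i k /=; rewrite in_itv /= -ler_norml /g !mxE.
have S0 : ordS i0 = i1 by exact: val_inj.
have S1 : ordS i1 = i2 by exact: val_inj.
have S2 : ordS i2 = i3 by exact: val_inj.
have S3 : ordS i3 = i4 by exact: val_inj.
have := step k i0; have := step k i1; have := step k i2; have := step k i3.
rewrite S0 S1 S2 S3 !ler_norml => h3 h2 h1 h0.
by elim/ord5_ind: i; lra.
Qed.

(** The quotient is the image of the configurations in a box, which are
    compact by Tychonoff's theorem. *)
Lemma sym_compact : compact [set: SC].
Proof.
have [->|/set0P[p0 _]] := eqVneq [set: SC] set0; first exact: compact0.
pose x0 : X := repr (repr p0).
pose ext (x : {ptws 'I_5 -> 'rV[R]_2}) : SC := class_of (insubd x0 x).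
have extE (x : X) : ext (set_val x) = class_of x by rewrite /ext valKd.
have ext_cont : {within conf, continuous ext}.
  apply/subspace_sigL_continuousP.
  rewrite (_ : sigL _ _ = class_of); first exact: class_of_continuous.
  by apply/funext => x; exact: extE.
have -> : [set: SC] = ext @` (box `&` conf).
  apply/seteqP; split => // p _.
  have [y [yB yE]] := conf_translate (repr (repr p)).
  exists (set_val y); first by split=> //; exact: set_valP.
  by rewrite extE yE /class_of !reprK.
apply: continuous_compact.
  by apply: continuous_subspaceW ext_cont => x [].
apply: compact_closedI; [exact: box_compact | exact: conf_closed].
Qed.

End Compact.

Theorem propositionD (R : realType) (l : R) (l_gt0 : 0 < l) :
  homeomorphic (sym_reduced_conf_space (pentagon l_gt0)) (set_type (closed_disc R)).
Proof.
apply: (@compact_bijection_homeomorphic _ _ (@sym_to_disc R l l_gt0)).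
- exact: sym_compact.
- apply: (@hausdorff_injective _ _ (set_val : set_type (closed_disc R) -> 'rV[R]_2)).
  + exact: initial_continuous.
  + exact: val_inj.
  + exact: norm_hausdorff.
- exact: sym_to_disc_continuous.
- exact: sym_to_disc_inj.
- exact: sym_to_disc_surj.
Qed.
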